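(* Every real-valued function $f\in\mathrm{VMO}(\mathbb{T})$ can be represented as the difference of two $\mathrm{VLO}$ functions; that is, there exist $f_1,f_2\in\mathrm{VLO}(\mathbb{T})$ such that $f=f_1-f_2$ almost everywhere on $\mathbb{T}$.
   Context: $\mathbb{T}$ is the unit circle in $\mathbb{C}$. Functions are real-valued and identified when equal almost everywhere. For an interval (arc) $I\subset\mathbb{T}$, $|I|$ denotes its arclength and $f_I=\frac{1}{|I|}\int_I f(x)\,dx$ the mean of $f$ over $I$ (with respect to arclength). An integrable function $f$ on $\mathbb{T}$ is in $\mathrm{BMO}(\mathbb{T})$ if $\sup_{I}\frac{1}{|I|}\int_I|f(x)-f_I|\,dx<\infty$, the supremum being over all intervals $I\subset\mathbb{T}$. It is in $\mathrm{VMO}(\mathbb{T})$ (vanishing mean oscillation) if $f\in\mathrm{BMO}(\mathbb{T})$ and $\lim_{|I|\to0}\frac{1}{|I|}\int_I|f(x)-f_I|\,dx=0$ uniformly over intervals $I$. An integrable function $f$ on $\mathbb{T}$ is in $\mathrm{VLO}(\mathbb{T})$ (vanishing lower oscillation) if $\lim_{|I|\to0}\bigl(f_I-\inf_I f\bigr)=0$, uniformly over intervals $I\subset\mathbb{T}$, where $\inf_I f$ denotes the essential infimum of $f$ on $I$. *)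

(* Defs.v *)
From mathcomp Require Import all_boot all_order all_algebra.
From mathcomp Require Import complex.
From mathcomp Require Import all_classical all_reals all_analysis.
From mathcomp Require Import ess_sup_inf.

Set Implicit Arguments.
Unset Strict Implicit.
Unset Printing Implicit Defensive.

Import Order.TTheory GRing.Theory Num.Theory.
Import numFieldNormedType.Exports.

Local Open Scope classical_set_scope.
Local Open Scope ring_scope.
Local Open Scope complex_scope.

Definition circle (R : realType) := {z : R[i] | `|z| == 1}.

Lemma norm_cis (R : realType) (t : R) : `|cos t +i* sin t| == 1.
Proof. by rewrite normc_def cos2Dsin2 sqrtr1. Qed.

Definition cis (R : realType) (t : R) : circle R :=
  exist (fun z : R[i] => `|z| == 1) (cos t +i* sin t) (norm_cis t).

(* Arclength on the circle is the image of the Lebesgue measure under the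
   unit-speed parametrization [cis].  The pair [(a, b)] stands for the arc
   [cis @` `[a, b]], of length [b - a]; every arc of positive length is of this
   form up to its endpoints, which are negligible.  The choice [b = a + 2 pi] is
   the whole circle. *)
Definition is_arc (R : realType) (a b : R) := a < b <= a + 2 * pi.

Definition arc_integral (R : realType) (a b : R) (f : circle R -> R) : R :=
  \int[lebesgue_measure]_(t in `[a, b]) f (cis t).

Definition arc_mean (R : realType) (a b : R) (f : circle R -> R) : R :=
  (b - a)^-1 * arc_integral a b f.

Definition arc_osc (R : realType) (a b : R) (f : circle R -> R) : R :=
  arc_mean a b (fun z => `|f z - arc_mean a b f|).

Definition arc_ess_inf (R : realType) (a b : R) (f : circle R -> R) : \bar R :=
  ess_inf (mrestr lebesgue_measure (measurable_itv `[a, b]))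
    (fun t => (f (cis t))%:E).

Definition circle_integrable (R : realType) (f : circle R -> R) :=
  lebesgue_measure.-integrable `[0, 2 * pi] (fun t => (f (cis t))%:E).

Definition ae_eq_circle (R : realType) (f g : circle R -> R) :=
  {ae lebesgue_measure, forall t : R, t \in `[0, 2 * pi] -> f (cis t) = g (cis t)}.

Definition BMO (R : realType) (f : circle R -> R) :=
  circle_integrable f /\
  (ereal_sup [set (arc_osc ab.1 ab.2 f)%:E | ab in [set ab | is_arc ab.1 ab.2]]
     < +oo)%E.

Definition VMO (R : realType) (f : circle R -> R) :=
  BMO f /\
  forall e : R, 0 < e -> exists2 d : R, 0 < d &
    forall a b : R, is_arc a b -> b - a < d -> `|arc_osc a b f| < e.

(* [arc_ess_inf] is extended-real: on an arc where [f] is not essentially bounded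
   below the difference is [+oo], and the condition fails. *)
Definition VLO (R : realType) (f : circle R -> R) :=
  circle_integrable f /\
  forall e : R, 0 < e -> exists2 d : R, 0 < d &
    forall a b : R, is_arc a b -> b - a < d ->
      (`|(arc_mean a b f)%:E - arc_ess_inf a b f| < e%:E)%E.

(* Main.v *)
From HB Require Import structures.
Require Import Defs.
From mathcomp Require Import all_boot all_order all_algebra.
From mathcomp Require Import all_classical all_reals all_analysis.
From mathcomp Require Import measurable_realfun ess_sup_inf zify ring lra.

(** Every arc is compared with the dyadic partitions of the circle shifted by a
    random angle [t], with cells of length [len j = 2 pi / 2 ^ j].  Fix moduli
    [eps j -> 0], decreasing slowly, which bound the mean oscillation of [f] on
    the arcs of length at most [len j].  Follow the averages of [f] on the cells
    containing [x], from coarse to fine, and "stop" at level [j] whenever the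
    average differs by more than [2 eps j] from its value at the last stop; a
    stop at level [j] costs [6 eps j].  A Calderon-Zygmund argument bounds the
    mean cost of the stops below level [k] on a cell of level [k] by
    [18 eps k].  Let [A x] be the total cost at [x], averaged over [t].
    On an arc [I] of length about [len k], the contribution to [A] of the levels
    above [k] is almost constant, since [I] is rarely cut by the coarse random
    partitions, and the finer levels contribute a nonnegative function of mean
    [O(eps k)]; hence [A] is in VLO.  The decrease of [f] from its mean on [I]
    to its value at [x] is at most the cost at [x] of the levels below [k], up
    to [O(eps k)]; hence [A + f] is in VLO as well, and [f = (A + f) - A]. *)

Set Implicit Arguments.
Unset Strict Implicit.
Unset Printing Implicit Defensive.

Import Order.TTheory GRing.Theory Num.Theory.
Import numFieldNormedType.Exports.

Local Open Scope classical_set_scope.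
Local Open Scope ring_scope.

(** * Periodic locally integrable functions *)

Section translation.
Context {R : realType}.
Local Notation mu := (@lebesgue_measure R).
Implicit Types (a b s : R) (F : R -> \bar R).

Definition addr_fun s (x : measurableTypeR R) : measurableTypeR R := x + s.

Lemma measurable_addr_fun s : measurable_fun setT (addr_fun s).
Proof. exact: measurable_funD. Qed.

HB.instance Definition _ s :=
  isMeasurableFun.Build _ _ _ _ (addr_fun s) (measurable_addr_fun s).

(** Uniqueness of Lebesgue measure: the translated measure also gives each half-open interval its
    length. *)
Lemma lebesgue_measure_addr s (A : set R) : measurable A ->
  pushforward mu (addr_fun s) A = mu A.
Proof.
move=> mA; apply/esym/(@lebesgue_measure_unique R (pushforward mu (addr_fun s))).
  move=> _ [[a b]] _ <-; transitivity (mu `]a - s, b - s]%classic); last first.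
    congr (mu _).
    by apply/seteqP; split => x /=; rewrite !in_itv/= /addr_fun ltrBlDr lerBrDr.
  rewrite !lebesgue_measure_itv/= !lte_fin ltrD2r.
  by case: ifPn => // _; rewrite -!EFinD; congr (_%:E); ring.
by [].
Qed.

Lemma preimage_addr_itvcc a b s :
  (fun x : R => x + s) @^-1` `[a + s, b + s]%classic = `[a, b]%classic.
Proof. by apply/seteqP; split => x /=; rewrite !in_itv/= !lerD2r. Qed.

Lemma ge0_integral_addr F a b s :
  measurable_fun `[a + s, b + s] F -> (forall x, (0 <= F x)%E) ->
  (\int[mu]_(x in `[(a + s)%R, (b + s)%R]) F x =
    \int[mu]_(x in `[a, b]) F (x + s)%R)%E.
Proof.
move=> mF F0.
rewrite [LHS](@eq_measure_integral _ _ _ _ (pushforward mu (addr_fun s))); last first.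
  by move=> A mA _; exact/esym/lebesgue_measure_addr.
rewrite (ge0_integral_pushforward (measurable_addr_fun s))//.
by rewrite preimage_addr_itvcc.
Qed.

Lemma measurable_fun_addr F a b s :
  measurable_fun `[a, b] (fun x => F (x + s)) ->
  measurable_fun `[a + s, b + s] F.
Proof.
move=> mF.
have -> : F = (fun x => F (x + s)) \o (fun x => x - s).
  by apply/funext => x /=; rewrite subrK.
apply: (@measurable_comp _ _ _ _ _ _ `[a, b]%classic) => //.
  move=> _ [x /= + <-]; rewrite /= !in_itv/=; lra.
exact: measurable_funB.
Qed.

Lemma integral_addr F a b s :
  measurable_fun `[a, b] (fun x => F (x + s)) ->
  (\int[mu]_(x in `[(a + s)%R, (b + s)%R]) F x =
    \int[mu]_(x in `[a, b]) F (x + s)%R)%E.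
Proof.
move=> /measurable_fun_addr mF; rewrite integralE [RHS]integralE.
rewrite ge0_integral_addr//; last exact: measurable_funepos.
rewrite ge0_integral_addr//; last exact: measurable_funeneg.
by congr (_ - _)%E; apply: eq_integral => x _; rewrite ?funeposE ?funenegE.
Qed.

Lemma integrable_addr F a b s :
  mu.-integrable `[a, b] (fun x => F (x + s)) ->
  mu.-integrable `[a + s, b + s] F.
Proof.
move=> /integrableP[mF Foo]; apply/integrableP; split.
  exact: measurable_fun_addr.
rewrite ge0_integral_addr//.
by apply: measurableT_comp => //; exact: measurable_fun_addr.
Qed.

Lemma integrable_itvU F a b c : a <= b -> b <= c ->
  mu.-integrable `[a, b] F -> mu.-integrable `[b, c] F ->
  mu.-integrable `[a, c] F.
Proof.
move=> ab bc /integrableP[m1 i1] /integrableP[m2 i2]; apply/integrableP.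
have E : `[a, c]%classic = `[a, b]%classic `|` `]b, c]%classic :> set R.
  by apply/seteqP; split => x /=; rewrite !in_itv/= => h;
    have := le_total x b; move: h; case: (ltP b x) => ?; lra.
have mF : measurable_fun `[a, c] F.
  rewrite E; apply/measurable_funU => //; split=> //.
  by apply: measurable_funS m2 => //; apply: subset_itvr; rewrite bnd_simp.
split => //.
rewrite E ge0_integral_setU//; last 2 first.
  by rewrite -E; exact: measurableT_comp.
  rewrite disj_set2E; apply/eqP/seteqP; split => x //= []; rewrite !in_itv/=; lra.
rewrite lte_add_pinfty//; apply: le_lt_trans i2.
apply: ge0_subset_integral => //; first exact: measurableT_comp.
by apply: subset_itvr; rewrite bnd_simp.
Qed.

(** Periods are glued into an interval [[0, T *+ (n + n)]], which is shifted to be symmetric about 0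
    and contains [[a, b]] for large [n]. *)
Lemma integrable_periodic (g : R -> R) (T : R) : 0 < T ->
  (forall x, g (x + T) = g x) ->
  mu.-integrable `[0, T] (EFin \o g) ->
  forall a b, mu.-integrable `[a, b] (EFin \o g).
Proof.
move=> T0 gT g0 a b.
have gnT n x : g (x + T *+ n) = g x.
  by elim: n x => [|n IH] x; rewrite ?mulr0n ?addr0// mulrS addrA IH gT.
have h1 n : mu.-integrable `[0, T *+ n] (EFin \o g).
  elim: n => [|n IH].
    by rewrite mulr0n; apply: integrableS g0 => //; apply: subset_itvl; rewrite bnd_simp ltW.
  apply: (@integrable_itvU _ 0 (T *+ n)) => //.
  - by rewrite mulrn_wge0// ltW.
  - by rewrite mulrS lerDr ltW.
  - rewrite mulrS -{1}[T *+ n]add0r; apply: integrable_addr.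
    apply: eq_integrable g0 => // x _ /=; by rewrite gnT.
have [n hn] : exists n, `|a| + `|b| < T *+ n.
  exists (Num.truncn ((`|a| + `|b|) / T)).+1.
  by rewrite -mulr_natl -ltr_pdivrMr// truncnS_gt.
have h2 : mu.-integrable `[- (T *+ n), T *+ n] (EFin \o g).
  have -> : - (T *+ n) = 0 + - (T *+ n) by rewrite add0r.
  have {2}-> : T *+ n = T *+ (n + n) + - (T *+ n) by rewrite mulrnDr addrK.
  apply: integrable_addr; apply: eq_integrable (h1 (n + n)%N) => // x _ /=.
  by rewrite -(gnT n (x - _)) subrK.
apply: integrableS h2 => // x /=; rewrite !in_itv/=.
have := ler_norm b; have := ler_norm (- a); rewrite normrN.
have := normr_ge0 a; have := normr_ge0 b; lra.
Qed.

End translation.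

(** * Means and deviations on intervals *)

Section interval_means.
Context {R : realType}.
Local Notation mu := (@lebesgue_measure R).
Implicit Types (a b c d p q : R).

Definition mean (g : R -> R) a b : R :=
  (b - a)^-1 * \int[mu]_(x in `[a, b]) g x.

(** Not divided by the length, so that it is monotone in the interval. *)
Definition absdev (g : R -> R) p a b : R := \int[mu]_(x in `[a, b]) `|g x - p|.

Variable g : R -> R.
Hypothesis gint : forall a b, mu.-integrable `[a, b] (EFin \o g).

Lemma measurable_locally_integrable : measurable_fun setT g.
Proof.
have -> : [set: R] = \bigcup_n `[- n%:R, n%:R]%classic.
  apply/esym; rewrite -subTset => x _.
  exists (Num.truncn `|x|).+1 => //=; rewrite in_itv/= -ler_norml.
  by rewrite ltW// truncnS_gt.
apply/measurable_fun_bigcup => // n.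
by have /integrableP[/measurable_EFinP] := gint (- n%:R) n%:R.
Qed.

Lemma fine_mu_itvcc a b : a <= b -> fine (mu `[a, b]) = b - a.
Proof.
rewrite le_eqVlt => /predU1P[->|ab].
  by rewrite set_itv1 lebesgue_measure_set1 subrr.
by rewrite lebesgue_measure_itv/= lte_fin ab.
Qed.

Lemma integrable_cst_itv p a b : mu.-integrable `[a, b] (EFin \o cst p).
Proof.
have ab_fin : (mu `[a, b] < +oo)%E.
  by rewrite lebesgue_measure_itv/=; case: ifP; rewrite ?ltry// -EFinB ltry.
apply: measurable_bounded_integrable => //.
by exists `|p|; split=> // M /ltW ? x _.
Qed.

Lemma integrable_sub_cst p a b : mu.-integrable `[a, b] (EFin \o (fun x => g x - p)).
Proof.
apply: (@eq_integrable _ _ _ mu _ _ ((EFin \o g) \- (EFin \o cst p))%E) => //.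
by apply: integrableB => //; exact: integrable_cst_itv.
Qed.

Lemma integrable_absdev p a b :
  mu.-integrable `[a, b] (EFin \o (fun x => `|g x - p|)).
Proof. exact: (integrable_norm (integrable_sub_cst p a b)). Qed.

Lemma Rintegral_sub_cst p a b : a < b ->
  \int[mu]_(x in `[a, b]) (g x - p) = (b - a) * (mean g a b - p).
Proof.
move=> ab; rewrite RintegralB//; last exact: integrable_cst_itv.
rewrite Rintegral_cst//= fine_mu_itvcc ?ltW// /mean [RHS]mulrBr mulrA divff ?mul1r.
  by rewrite (mulrC p).
by rewrite subr_eq0 gt_eqF.
Qed.

Lemma mean_absdev p a b : a < b -> (b - a) * `|mean g a b - p| <= absdev g p a b.
Proof.
move=> ab; rewrite -(@gtr0_norm _ (b - a)) ?subr_gt0// -normrM -Rintegral_sub_cst//.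
by apply: le_normr_Rintegral => //; exact: integrable_sub_cst.
Qed.

Lemma absdev_ge0 p a b : 0 <= absdev g p a b.
Proof. by apply: Rintegral_ge0. Qed.

Lemma integral_absdev p a b :
  (\int[mu]_(x in `[a, b]) `|g x - p|%:E = (absdev g p a b)%:E)%E.
Proof.
by rewrite fineK//; apply: integrable_fin_num => //; exact: integrable_absdev.
Qed.

Lemma absdevS p a b c d : c <= a -> b <= d -> absdev g p a b <= absdev g p c d.
Proof.
move=> ca bd; rewrite -lee_fin -!integral_absdev; apply: ge0_subset_integral => //.
  by apply: measurable_int; exact: integrable_absdev.
by apply: subset_itv; rewrite bnd_simp.
Qed.

Lemma absdev_triangle p q a b : a <= b ->
  absdev g p a b <= absdev g q a b + (b - a) * `|q - p|.
Proof.
move=> ab.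
have -> : (b - a) * `|q - p| = \int[mu]_(x in `[a, b]) `|q - p|.
  by rewrite Rintegral_cst//= fine_mu_itvcc// mulrC.
rewrite -RintegralD//; last 2 first.
  exact: integrable_absdev.
  exact: integrable_cst_itv.
apply: le_Rintegral => //.
- exact: integrable_absdev.
- have := @integrableD _ _ _ mu `[a, b]%classic _ _ _ (integrable_absdev q a b)
    (integrable_cst_itv `|q - p| a b).
  by apply.
- by move=> x _; rewrite (le_trans _ (ler_normD _ _))// addrA subrK.
Qed.

(** The deviation over the smaller interval is dominated by the one over the larger; averages over
    nested intervals are compared at the price of the ratio of lengths. *)
Lemma mean_sub_mean a b c d : c <= a -> a < b -> b <= d ->
  (b - a) * `|mean g a b - mean g c d| <= absdev g (mean g c d) c d.
Proof.
by move=> ca ab bd; rewrite (le_trans (mean_absdev _ ab))// absdevS.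
Qed.

End interval_means.

(** * The stopping process *)

Section stopping.
Context {R : realType}.
Local Notation mu := (@lebesgue_measure R).
Variables (T : R) (g : R -> R) (eps : nat -> R).
Implicit Types (a b c d p q x y t : R) (i : int) (j k : nat).

Definition len j : R := T / 2 ^+ j.

(** The number of the half-open cell of level [j] containing [x] in the grid shifted by [t]; the
    quantities below depend on [x] only through it. *)
Definition idx j x t : int := Num.floor ((x - t) / len j).

Definition avg j x t : R :=
  mean g (t + len j * (idx j x t)%:~R) (t + len j * (idx j x t)%:~R + len j).

(* The average at the last stop up to level [j]; level 0 is the initial value. *)
Fixpoint approx j x t : R :=
  if j is j'.+1 then
    if 2 * eps j < `|avg j x t - approx j' x t| then avg j x t else approx j' x t
  else avg 0 x t.

Definition stop j x t : bool :=
  if j is j'.+1 then 2 * eps j < `|avg j x t - approx j' x t| else false.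

(** The charge [6 * eps j] is the bound of [avgS_approx] on the change of [approx] at a stop. *)
Definition jump j x t : R := 6 * eps j * (stop j x t)%:R.

Hypothesis T0 : 0 < T.

Lemma len_gt0 j : 0 < len j.
Proof. by rewrite divr_gt0// exprn_gt0. Qed.
Local Hint Resolve len_gt0 : core.

Lemma len0 : len 0 = T. Proof. by rewrite /len expr0 divr1. Qed.

Lemma lenS j : len j = 2 * len j.+1.
Proof. by rewrite /len exprS; field; rewrite expf_neq0. Qed.

Lemma idx_itv j x t :
  t + len j * (idx j x t)%:~R <= x < t + len j * (idx j x t)%:~R + len j.
Proof.
have /andP[] := floor_itv ((x - t) / len j); rewrite -/(idx j x t).
rewrite ler_pdivlMr// ltr_pdivrMr// intrD.
by set u := _%:~R; set l := len j => h1 h2; lra.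
Qed.

Lemma idx_unique j i x t : t + len j * i%:~R <= x < t + len j * i%:~R + len j ->
  idx j x t = i.
Proof.
move=> /andP[h1 h2]; apply: floor_def; rewrite ler_pdivlMr// ltr_pdivrMr// intrD.
by move: h1 h2; set u := _%:~R; set l := len j => h1 h2; apply/andP; split; lra.
Qed.

(** Grids with a common shift are nested: each cell is halved, and [x] lies to the left or to the
    right of the midpoint. *)
Lemma idxS j x t :
  idx j.+1 x t = 2 * idx j x t \/ idx j.+1 x t = 2 * idx j x t + 1.
Proof.
have := idx_itv j x t; rewrite lenS => /andP[h1 h2].
have [h3|h3] := ltP x (t + len j.+1 * (2 * idx j x t)%:~R + len j.+1).
  left; apply: idx_unique; apply/andP; split=> //.
  by move: h1; rewrite intrM; lra.
right; apply: idx_unique; move: h1 h2 h3; rewrite intrD intrM/=.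
set u := (idx _ _ _)%:~R; set l := len _ => h1 h2 h3.
by apply/andP; split; lra.
Qed.

(** A fine cell determines all coarser ones; hence the whole history of the stopping process is
    constant on a cell. *)
Lemma idx_coarser j x y t : idx j.+1 x t = idx j.+1 y t -> idx j x t = idx j y t.
Proof. by move: (idxS j x t) (idxS j y t) => [->|->] [->|->]; lia. Qed.

Lemma approx_idx j x y t : idx j x t = idx j y t -> approx j x t = approx j y t.
Proof.
elim: j => [|j IH] xy /=; rewrite /avg xy//.
by rewrite (IH (idx_coarser xy)).
Qed.

Lemma stop_idx j x y t : idx j x t = idx j y t -> stop j x t = stop j y t.
Proof.
by case: j => [//|j] xy /=; rewrite /avg xy (approx_idx (idx_coarser xy)).
Qed.

Lemma jump_idx j x y t : idx j x t = idx j y t -> jump j x t = jump j y t.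
Proof. by move=> xy; rewrite /jump (stop_idx xy). Qed.

Section periodic.
Hypothesis gT : forall x, g (x + T) = g x.
Hypothesis gint : forall a b, mu.-integrable `[a, b] (EFin \o g).

Lemma mean_addT a b : mean g (a + T) (b + T) = mean g a b.
Proof.
rewrite /mean opprD addrACA subrr addr0; congr (_ * fine _).
rewrite integral_addr; last first.
  apply/measurable_EFinP; apply: (@eq_measurable_fun _ _ _ _ _ g).
    by move=> x _; rewrite gT.
  by have /integrableP[/measurable_EFinP] := gint a b.
by apply: eq_integral => x _; rewrite gT.
Qed.

(** A period consists of exactly [2 ^ j] cells of level [j]; this passes the periodicity of [g] on
    to the stopping process. *)
Lemma idx_addT j x t : idx j (x + T) t = idx j x t + (2 ^ j)%:Z.
Proof.
apply: idx_unique; have := idx_itv j x t; rewrite intrD mulrDr.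
have -> : len j * (2 ^ j)%:Z%:~R = T.
  by rewrite -pmulrn natrX /len divfK// expf_neq0.
by set u := _%:~R; set l := len j => /andP[h1 h2]; apply/andP; split; lra.
Qed.

Lemma avg_addT j x t : avg j (x + T) t = avg j x t.
Proof.
rewrite /avg idx_addT intrD mulrDr.
have -> : len j * (2 ^ j)%:Z%:~R = T.
  by rewrite -pmulrn natrX /len divfK// expf_neq0.
by rewrite -[RHS]mean_addT; congr mean; ring.
Qed.

Lemma approx_addT j x t : approx j (x + T) t = approx j x t.
Proof. by elim: j => [|j IH] /=; rewrite avg_addT ?IH. Qed.

Lemma jump_addT j x t : jump j (x + T) t = jump j x t.
Proof. by rewrite /jump; case: j => [//|j] /=; rewrite avg_addT approx_addT. Qed.

End periodic.

Section oscillation.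
Hypothesis gint : forall a b, mu.-integrable `[a, b] (EFin \o g).
Hypothesis eps_gt0 : forall j, 0 < eps j.
Hypothesis epsS : forall j, eps j <= 3 / 2 * eps j.+1.
Hypothesis gosc : forall j a b, a < b -> b <= a + len j ->
  absdev g (mean g a b) a b <= eps j * (b - a).

(** The deviation on the cell of level [j] is at most [eps j * len j]; dividing by the length of its
    half gives the factor 2. *)
Lemma avgS j x t : `|avg j.+1 x t - avg j x t| <= 2 * eps j.
Proof.
rewrite -(@ler_pM2l _ (len j.+1))//.
set c := t + len j.+1 * (idx j.+1 x t)%:~R; set d := t + len j * (idx j x t)%:~R.
have h : d <= c /\ c + len j.+1 <= d + len j.
  rewrite /c /d (lenS j); have [->|->] := idxS j x t; rewrite ?intrD intrM.
    by split; have := len_gt0 j.+1; set l := len _; set u := (idx _ _ _)%:~R; lra.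
  by split; have := len_gt0 j.+1; set l := len _; set u := (idx _ _ _)%:~R; lra.
have := mean_sub_mean gint h.1 _ h.2; rewrite ltrDl => /(_ (len_gt0 _)).
rewrite [c + _ - c]addrC addKr => /le_trans; apply.
have := @gosc j d (d + len j); rewrite ltrDl => /(_ (len_gt0 _) (lexx _)).
rewrite [d + _ - d]addrC addKr => /le_trans; apply.
by rewrite lenS; lra.
Qed.

(** Without a stop this is the failed test; at a stop, or at level 0, the two values agree. *)
Lemma avg_approx j x t : `|avg j x t - approx j x t| <= 2 * eps j.
Proof.
have e0 := eps_gt0 j.
by case: j e0 => [|j] e0 /=; [|case: ltP => // _]; rewrite subrr normr0; lra.
Qed.

(** The passage to the finer average and the gap to the last stop cost [2 * eps j] each, and [epsS]
    turns [4 * eps j] into [6 * eps j.+1]. *)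
Lemma avgS_approx j x t : `|avg j.+1 x t - approx j x t| <= 6 * eps j.+1.
Proof.
have := avgS j x t; have := avg_approx j x t; have := epsS j.
have := ler_distD (avg j x t) (avg j.+1 x t) (approx j x t); lra.
Qed.

Lemma jump_ge0 j x t : 0 <= jump j x t.
Proof. by rewrite mulr_ge0// mulr_ge0// ltW. Qed.

Lemma approxS j x t : `|approx j.+1 x t - approx j x t| <= jump j.+1 x t.
Proof.
rewrite /jump /=; case: ifP => _; rewrite ?subrr ?normr0 ?mulr0//.
by rewrite mulr1 avgS_approx.
Qed.

Lemma approx_sum k n x t :
  `|approx (k + n) x t - approx k x t| <= \sum_(k <= j < k + n) jump j.+1 x t.
Proof.
elim: n => [|n IH]; first by rewrite addn0 subrr normr0 big_geq.
rewrite addnS big_nat_recr ?leq_addr//=.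
have := approxS (k + n) x t.
have := ler_distD (approx (k + n) x t) (approx (k + n).+1 x t) (approx k x t).
lra.
Qed.

(** The approximations telescope by [approx_sum], and each end adds its gap to the true average. *)
Lemma avg_sum k n x t :
  `|avg (k + n) x t - avg k x t| <=
    \sum_(k <= j < k + n) jump j.+1 x t + 2 * eps k + 2 * eps (k + n).
Proof.
have := approx_sum k n x t; have := avg_approx k x t; have := avg_approx (k + n) x t.
have := ler_distD (approx (k + n) x t) (avg (k + n) x t) (avg k x t).
have := ler_distD (approx k x t) (approx (k + n) x t) (avg k x t).
rewrite (distrC (approx k x t)); lra.
Qed.

(* When the process stops, [absdev g (avg j.+1 x t)] is at most [eps j.+1 * l] by
   the oscillation bound, whereas [absdev g (approx j x t)] exceeds
   [2 * eps j.+1 * l]. *)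
Lemma stopping_step j x t (c := t + len j.+1 * (idx j.+1 x t)%:~R) :
  len j.+1 * jump j.+1 x t + 6 * absdev g (approx j.+1 x t) c (c + len j.+1)
  <= 6 * absdev g (approx j x t) c (c + len j.+1).
Proof.
rewrite /jump /=; case: ltP => [h|_]; last by rewrite !mulr0 add0r.
have := @gosc j.+1 c (c + len j.+1); rewrite ltrDl => /(_ (len_gt0 _) (lexx _)).
have := @mean_absdev _ _ gint (approx j x t) c (c + len j.+1).
rewrite ltrDl => /(_ (len_gt0 _)).
rewrite [c + _ - c]addrC addKr -/(avg j.+1 x t) => h1 h2.
have : len j.+1 * (2 * eps j.+1) <= len j.+1 * `|avg j.+1 x t - approx j x t|.
  by rewrite ler_pM2l// ltW.
rewrite mulr1; lra.
Qed.

(** The oscillation on the cell gives [eps k], the gap between [avg] and [approx] gives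
    [2 * eps k]. *)
Lemma absdev_approx k x t (c := t + len k * (idx k x t)%:~R) :
  absdev g (approx k x t) c (c + len k) <= 3 * eps k * len k.
Proof.
have cc : c < c + len k by rewrite ltrDl.
have := absdev_triangle gint (approx k x t) (avg k x t) (ltW cc).
have := gosc cc (lexx _); rewrite [c + _ - c]addrC addKr -/(avg k x t).
have : len k * `|avg k x t - approx k x t| <= len k * (2 * eps k).
  by rewrite ler_pM2l// avg_approx.
lra.
Qed.

End oscillation.
End stopping.

(** * Joint measurability in the point and the shift *)

Section joint_measurability.
Context {R : realType}.
Local Notation mu := (@lebesgue_measure R).
Local Notation TR := (measurableTypeR R).

(** Meant for [N] the cell number: once it is fixed, the average over the cell depends on the shift
    alone. *)
Lemma measurable_fun_countable_glue d d' (X : measurableType d)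
    (Y : measurableType d') (I : countType) (N : X -> I) (h : I -> X -> Y) :
  (forall i, measurable (N @^-1` [set i])) ->
  (forall i, measurable_fun setT (h i)) ->
  measurable_fun setT (fun z => h (N z) z).
Proof.
move=> mN mh.
pose E n : set X := if unpickle n is Some i then N @^-1` [set i] else set0.
have mE n : measurable (E n) by rewrite /E; case: unpickle.
have -> : [set: X] = \bigcup_n E n.
  apply/esym; rewrite -subTset => z _.
  by exists (pickle (N z)) => //; rewrite /E pickleK.
apply/measurable_fun_bigcup => // n; rewrite /E.
case: unpickle => [i|]; last exact: measurable_fun_set0.
apply: (@eq_measurable_fun _ _ _ _ _ (h i)).
  by move=> z; rewrite inE/= => ->.
exact: measurable_funS (mh i).
Qed.

(** For bounded [t] the integral is a difference of two values of a primitive of [g], which is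
    continuous. *)
Lemma measurable_Rintegral_shift (g : R -> R) (a l : R) :
  0 <= l -> (forall a b, mu.-integrable `[a, b] (EFin \o g)) ->
  measurable_fun setT (fun t : TR => \int[mu]_(x in `[t + a, t + a + l]) g x : TR).
Proof.
move=> l0 gint.
have -> : [set: TR] = \bigcup_n `[- n%:R, n%:R]%classic.
  apply/esym; rewrite -subTset => x _.
  exists (Num.truncn `|x : R|).+1 => //=; rewrite in_itv/= -ler_norml.
  by rewrite ltW// truncnS_gt.
apply/measurable_fun_bigcup => // n.
(* With this [B], [[- B, B]] contains every [[t + a, t + a + l]] with [t] between [- n] and [n]. *)
pose B := n%:R + `|a| + l.
have a1 := ler_norm a; have a2 := ler_norm (- a); rewrite normrN in a2.
have n0 : (0 : R) <= n%:R by [].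
have B0 : - B <= B by rewrite /B; lra.
pose G u := \int[mu]_(x in `[- B, u]) g x.
have mG : measurable_fun `[- B, B] G.
  apply: subspace_continuous_measurable_fun => //.
  exact: (parameterized_integral_continuous B0).
have mGs (c : R) : `|c| <= `|a| + l ->
    measurable_fun `[- n%:R : R, n%:R] (fun t : TR => G (t + c) : TR).
  move=> ca.
  apply: (@measurable_comp _ _ _ _ _ _ `[- B, B]%classic G _
    (fun t : TR => t + c : TR)) => //.
    move=> _ [x /= + <-]; rewrite !in_itv/= /B.
    have := ler_norm c; have := ler_norm (- c); rewrite normrN; lra.
  exact: measurable_funD.
apply: (@eq_measurable_fun _ _ _ _ _ (fun t : TR => G (t + (a + l)) - G (t + a) : TR)).
  move=> t; rewrite inE/= in_itv/= => tn; rewrite /G addrA.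
  rewrite Rintegral_itvB//.
  - rewrite Rintegral_itv_obnd_cbnd//.
    apply: integrableS (gint (t + a) (t + a + l)) => //.
    by apply: subset_itvr; rewrite bnd_simp.
  - by rewrite bnd_simp /B; lra.
  - by rewrite bnd_simp; lra.
apply: measurable_funB; apply: mGs; last lra.
by rewrite (le_trans (ler_normD _ _))// lerD2l ger0_norm.
Qed.

Variables (T : R) (g : R -> R) (eps : nat -> R).
Hypothesis T0 : 0 < T.
Hypothesis gint : forall a b, mu.-integrable `[a, b] (EFin \o g).

Lemma measurable_idx j i :
  measurable ((fun z : TR * TR => idx T j z.1 z.2) @^-1` [set i]).
Proof.
have m : measurable_fun setT (fun z : TR * TR => (z.1 : R) - z.2 : TR).
  by apply: measurable_funB.
rewrite (_ : _ @^-1` _ =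
  (fun z : TR * TR => (z.1 : R) - z.2) @^-1`
    `[len T j * i%:~R, len T j * i%:~R + len T j[%classic).
  by rewrite -[X in measurable X]setTI; exact: m.
apply/seteqP; split => [z /= <-|z /=]; rewrite ?in_itv/=.
  have /andP[h1 h2] := idx_itv T0 j z.1 z.2.
  by apply/andP; split; lra.
by move=> /andP[h1 h2]; apply: idx_unique => //; apply/andP; split; lra.
Qed.

Lemma measurable_avg j :
  measurable_fun setT (fun z : TR * TR => avg T g j z.1 z.2 : TR).
Proof.
apply: (@measurable_fun_countable_glue _ _ (TR * TR)%type TR int
  (fun z => idx T j z.1 z.2)
  (fun i z => mean g (z.2 + len T j * i%:~R) (z.2 + len T j * i%:~R + len T j))).
  exact: measurable_idx.
move=> i; rewrite /mean.
have -> : (fun z : TR * TR =>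
   (z.2 + len T j * i%:~R + len T j - (z.2 + len T j * i%:~R))^-1 *
   \int[mu]_(x in `[(z.2 + len T j * i%:~R)%R,
     (z.2 + len T j * i%:~R + len T j)%R]) g x) =
  (fun z : TR * TR => (len T j)^-1 *
   \int[mu]_(x in `[(z.2 + len T j * i%:~R)%R,
     (z.2 + len T j * i%:~R + len T j)%R]) g x).
  by apply/funext => z; rewrite [_ + len T j - _]addrC addKr.
apply: measurable_funM => //.
apply: (@measurableT_comp _ _ _ _ _ _
  (fun t : TR => \int[mu]_(x in `[(t + len T j * i%:~R)%R,
     (t + len T j * i%:~R + len T j)%R]) g x : TR)) => //.
by apply: measurable_Rintegral_shift => //; rewrite ltW// len_gt0.
Qed.

Lemma measurable_approx j :
  measurable_fun setT (fun z : TR * TR => approx T g eps j z.1 z.2 : TR).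
Proof.
elim: j => [|j IH] /=; first exact: measurable_avg.
apply: measurable_fun_ifT => //; last exact: measurable_avg.
apply: measurable_fun_ltr => //; apply: measurableT_comp => //.
by apply: measurable_funB => //; exact: measurable_avg.
Qed.

Lemma measurable_jump j :
  measurable_fun setT (fun z : TR * TR => jump T g eps j z.1 z.2 : TR).
Proof.
rewrite (_ : (fun _ => _) = fun z : TR * TR =>
    if stop T g eps j z.1 z.2 then 6 * eps j else 0); last first.
  by apply/funext => z; rewrite /jump; case: ifP; rewrite ?mulr1 ?mulr0.
apply: measurable_fun_ifT => //; case: j => [|j] //=.
apply: measurable_fun_ltr => //; apply: measurableT_comp => //.
by apply: measurable_funB; [exact: measurable_avg|exact: measurable_approx].
Qed.

End joint_measurability.

(** * Packing bound for the cost of the stops *)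

Section packing.
Context {R : realType}.
Local Notation mu := (@lebesgue_measure R).
Local Notation TR := (measurableTypeR R).
Variables (T : R) (g : R -> R) (eps : nat -> R).
Hypothesis T0 : 0 < T.
Hypothesis gint : forall a b, mu.-integrable `[a, b] (EFin \o g).
Hypothesis eps_gt0 : forall j, 0 < eps j.
Hypothesis gosc : forall j a b, a < b -> b <= a + len T j ->
  absdev g (mean g a b) a b <= eps j * (b - a).
Local Notation len := (len T).
Local Notation idx := (idx T).
Local Notation jump := (jump T g eps).
Local Notation approx := (approx T g eps).

Lemma ge0_tonelli_itv (I J : set TR) (phi : TR * TR -> \bar R) :
  measurable I -> measurable J -> measurable_fun setT phi ->
  (forall z, (0 <= phi z)%E) ->
  (\int[mu]_(x in I) \int[mu]_(t in J) phi (x, t) =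
   \int[mu]_(t in J) \int[mu]_(x in I) phi (x, t))%E.
Proof.
move=> mI mJ mphi phi0.
have mIJ : measurable (I `*` J) by exact: measurableX.
have m : measurable_fun setT (phi \_ (I `*` J)).
  by apply: (measurable_restrictT _ mIJ).1; exact: measurable_funTS.
have p0 z : (0 <= (phi \_ (I `*` J)) z)%E by rewrite patchE; case: ifP.
have := @fubini_tonelli _ _ _ _ _ mu mu _ m p0.
rewrite [X in X = _ -> _](_ : _ =
  (\int[mu]_(x in I) \int[mu]_(t in J) phi (x, t))%E); last first.
  rewrite [RHS]integral_mkcond; apply: eq_integral => x _.
  rewrite patchE; case: ifPn => xI.
    rewrite [RHS]integral_mkcond; apply: eq_integral => t _.
    by rewrite !patchE in_setX/= xI.
  by rewrite integral0_eq// => t _; rewrite patchE in_setX/= (negbTE xI).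
move=> ->; rewrite [RHS]integral_mkcond; apply: eq_integral => t _.
rewrite patchE; case: ifPn => tJ.
  rewrite [RHS]integral_mkcond; apply: eq_integral => x _.
  by rewrite !patchE in_setX/= tJ andbT.
by rewrite integral0_eq// => x _; rewrite patchE in_setX/= (negbTE tJ) andbF.
Qed.

(** Half-open, so that the cells of one level partition the line; the closed intervals in [avg] and
    [absdev] have the same integrals. *)
Definition cell k i t : set R := `[t + len k * i%:~R, t + len k * i%:~R + len k[%classic.

Lemma cell_idx k i x t : cell k i t x -> idx k x t = i.
Proof. by rewrite /cell/= in_itv/=; exact: idx_unique. Qed.

Lemma cellS k i t : cell k i t = cell k.+1 (2 * i) t `|` cell k.+1 (2 * i + 1) t.
Proof.
apply/seteqP; rewrite /cell lenS intrD intrM/=; have := len_gt0 T0 k.+1.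
set l := len _; set u := i%:~R => l0.
split => x /=; rewrite !in_itv/=.
  by case: (ltP x (t + l * (2 * u) + l)) => h1 /andP[h2 h3];
    [left|right]; apply/andP; split; lra.
by case=> /andP[h1 h2]; apply/andP; split; lra.
Qed.

(** A cell is the disjoint union of its halves, so an inequality of integrals on the fine cells adds
    up to one on the coarse cells. *)
Lemma cell_lift (H1 H2 : R -> \bar R) j n t :
  measurable_fun setT H1 -> measurable_fun setT H2 ->
  (forall x, (0 <= H1 x)%E) -> (forall x, (0 <= H2 x)%E) ->
  (forall i, (\int[mu]_(x in cell (j + n) i t) H1 x <=
              \int[mu]_(x in cell (j + n) i t) H2 x)%E) ->
  forall i, (\int[mu]_(x in cell j i t) H1 x <= \int[mu]_(x in cell j i t) H2 x)%E.
Proof.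
move=> m1 m2 p1 p2; elim: n j => [|n IH] j; first by rewrite addn0.
rewrite addnS -addSn => /IH {}IH i; rewrite cellS.
have dis : [disjoint cell j.+1 (2 * i) t & cell j.+1 (2 * i + 1) t].
  apply/disj_setPS => x [/cell_idx h1 /cell_idx h2]; exfalso.
  by move: h2; rewrite h1; lia.
rewrite !ge0_integral_setU//; try exact: measurable_itv; try exact: measurable_funTS.
exact: leeD.
Qed.

(** The shape of the integrands below on one cell, where [jump] and [approx] are constants. *)
Lemma integral_absdev_shift p J a l : 0 < l -> 0 <= J ->
  (\int[mu]_(x in `[a, (a + l)%R[) (J + 6 * `|g x - p|)%:E =
    (l * J + 6 * absdev g p a (a + l))%:E)%E.
Proof.
move=> l0 J0.
have mg : measurable_fun `[a, a + l] (fun x => `|g x - p|).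
  by have /measurable_int/measurable_EFinP := integrable_absdev gint p a (a + l).
rewrite integral_itv_bndo_bndc; last first.
  apply/measurable_EFinP; apply: measurable_funD => //; apply: measurable_funM => //.
  by apply: measurable_funS mg => //; apply: subset_itvl; rewrite bnd_simp.
under eq_integral do rewrite EFinD.
have m6 : measurable_fun `[a, a + l] (fun x => (6 * `|g x - p|)%:E).
  by apply/measurable_EFinP; exact: measurable_funM.
rewrite ge0_integralD//.
under [X in (_ + X)%E]eq_integral do rewrite EFinM.
rewrite ge0_integralZl//; last exact/measurable_EFinP.
rewrite integral_absdev// integral_cst//= lebesgue_measure_itv/= lte_fin ltrDl l0.
by rewrite -EFinB -!EFinM -EFinD; congr (_%:E); ring.
Qed.

Lemma cell_step j i t :
  (\int[mu]_(x in cell j.+1 i t) (jump j.+1 x t + 6 * `|g x - approx j.+1 x t|)%:E <=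
   \int[mu]_(x in cell j.+1 i t) (6 * `|g x - approx j x t|)%:E)%E.
Proof.
have l0 := len_gt0 T0 j.+1.
(* The left end represents the cell: [jump] and [approx] take their constant values there. *)
pose c := t + len j.+1 * i%:~R.
have ci : idx j.+1 c t = i by apply: idx_unique => //; rewrite lexx ltrDl.
rewrite (eq_integral (fun x : TR =>
    (jump j.+1 c t + 6 * `|g x - approx j.+1 c t|)%:E)); last first.
  move=> x /set_mem/cell_idx xi; have xc : idx j.+1 x t = idx j.+1 c t by rewrite xi.
  by rewrite (jump_idx _ _ T0 xc) (approx_idx _ _ T0 xc).
rewrite [leRHS](eq_integral (fun x : TR => (0 + 6 * `|g x - approx j c t|)%:E)); last first.
  move=> x /set_mem/cell_idx xi; have xc : idx j.+1 x t = idx j.+1 c t by rewrite xi.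
  by rewrite (approx_idx _ _ T0 (idx_coarser T0 xc)) add0r.
rewrite !integral_absdev_shift//; last exact: jump_ge0.
rewrite lee_fin mulr0 add0r.
have := stopping_step T0 gint gosc j c t; by rewrite ci.
Qed.

Lemma measurable_jumpx j t : measurable_fun setT (fun x : TR => jump j x t : TR).
Proof. exact (measurable_fun_pair1 t (measurable_jump eps T0 gint j)). Qed.

Lemma measurable_dev j t :
  measurable_fun setT (fun x : TR => `|g x - approx j x t| : TR).
Proof.
apply: measurableT_comp => //; apply: measurable_funB.
  exact: measurable_locally_integrable.
exact (measurable_fun_pair1 t (measurable_approx eps T0 gint j)).
Qed.

Lemma measurable_sum_jump k n t :
  measurable_fun setT (fun x : TR => \sum_(k <= j < k + n) jump j.+1 x t : TR).
Proof. by apply: measurable_sum => j; exact: measurable_jumpx. Qed.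

(** Six times the deviation of [g] from [approx] acts as a potential: by [cell_step] every stop is
    paid for by a decrease of its integral. *)
Lemma packing k n i t :
  (\int[mu]_(x in cell k i t)
     (\sum_(k <= j < k + n) jump j.+1 x t + 6 * `|g x - approx (k + n) x t|)%:E <=
   \int[mu]_(x in cell k i t) (6 * `|g x - approx k x t|)%:E)%E.
Proof.
elim: n => [|n IH].
  by under eq_integral do rewrite addn0 big_geq// add0r.
apply: le_trans IH; rewrite addnS.
have sum0 x : 0 <= \sum_(k <= j < k + n) jump j.+1 x t.
  by rewrite sumr_ge0// => j _; exact: jump_ge0.
under eq_integral do rewrite big_nat_recr ?leq_addr//= -addrA EFinD.
under [leRHS]eq_integral do rewrite EFinD.
have mdev j : measurable_fun setT (fun x : TR => (6 * `|g x - approx j x t|)%:E).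
  by apply/measurable_EFinP/measurable_funM => //; exact: measurable_dev.
have mstep : measurable_fun setT
    (fun x : TR => (jump (k + n).+1 x t + 6 * `|g x - approx (k + n).+1 x t|)%:E).
  apply/measurable_EFinP/measurable_funD; first exact: measurable_jumpx.
  by apply/measurable_EFinP; exact: mdev.
have pstep (x : R) : (0 <= (jump (k + n).+1 x t + 6 * `|g x - approx (k + n).+1 x t|)%:E)%E.
  by rewrite lee_fin; apply: addr_ge0; [exact: jump_ge0|exact: mulr_ge0].
have pdev j (x : R) : (0 <= (6 * `|g x - approx j x t|)%:E)%E.
  by rewrite lee_fin mulr_ge0.
have msum : measurable_fun (cell k i t)
    (fun x : TR => (\sum_(k <= j < k + n) jump j.+1 x t)%:E).
  by apply/measurable_EFinP/measurable_funTS; exact: measurable_sum_jump.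
rewrite !ge0_integralD//; try exact: measurable_funTS; try exact: measurable_itv;
  try by move=> x _; rewrite lee_fin.
apply: leeD2l.
(* The common sum is gone; the remaining inequality holds on the cells of level [(k + n).+1], which
   tile the cell of level [k]. *)
apply: (cell_lift (n := n.+1) mstep (mdev _) pstep (pdev _)) => i'.
by rewrite addnS; exact: cell_step.
Qed.

(** The final potential is dropped, and the initial one is 6 times the bound [3 * eps k * len k] of
    [absdev_approx]. *)
Lemma packing_cell k n i t :
  (\int[mu]_(x in cell k i t) (\sum_(k <= j < k + n) jump j.+1 x t)%:E <=
    (18 * eps k * len k)%:E)%E.
Proof.
have l0 := len_gt0 T0 k.
have sum0 x : 0 <= \sum_(k <= j < k + n) jump j.+1 x t.
  by rewrite sumr_ge0// => j _; exact: jump_ge0.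
apply: (@le_trans _ _ (\int[mu]_(x in cell k i t)
     (\sum_(k <= j < k + n) jump j.+1 x t + 6 * `|g x - approx (k + n) x t|)%:E)%E).
  apply: ge0_le_integral => //; try exact: measurable_itv.
  - by move=> x _; rewrite lee_fin.
  - by apply/measurable_EFinP/measurable_funTS; exact: measurable_sum_jump.
  - apply/measurable_EFinP/measurable_funTS/measurable_funD; first exact: measurable_sum_jump.
    by apply: measurable_funM => //; exact: measurable_dev.
  - by move=> x _; rewrite lee_fin lerDl mulr_ge0.
apply: le_trans (packing k n i t) _.
pose c := t + len k * i%:~R.
have ci : idx k c t = i by apply: idx_unique => //; rewrite lexx ltrDl.
rewrite (eq_integral (fun x : TR => (0 + 6 * `|g x - approx k c t|)%:E)); last first.
  move=> x /set_mem/cell_idx xi; have xc : idx k x t = idx k c t by rewrite xi.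
  by rewrite (approx_idx _ _ T0 xc) add0r.
rewrite integral_absdev_shift// lee_fin mulr0 add0r.
have := absdev_approx T0 gint eps_gt0 gosc k c t; rewrite ci => /= h; rewrite -/c in h; lra.
Qed.

(** An interval of length at most [len k] is covered by two neighbouring cells, which doubles the
    constant 18. *)
Lemma packing_itv k n a b t : b <= a + len k ->
  (\int[mu]_(x in `[a, b]) (\sum_(k <= j < k + n) jump j.+1 x t)%:E <=
    (36 * eps k * len k)%:E)%E.
Proof.
move=> ab; have l0 := len_gt0 T0 k.
have sum0 x : 0 <= \sum_(k <= j < k + n) jump j.+1 x t.
  by rewrite sumr_ge0// => j _; exact: jump_ge0.
pose i := idx k a t.
have m : measurable_fun setT (fun x : TR => (\sum_(k <= j < k + n) jump j.+1 x t)%:E).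
  by apply/measurable_EFinP; exact: measurable_sum_jump.
apply: (@le_trans _ _ (\int[mu]_(x in cell k i t `|` cell k (i + 1) t)
     (\sum_(k <= j < k + n) jump j.+1 x t)%:E)%E).
  apply: ge0_subset_integral => //.
  - by apply: measurableU; exact: measurable_itv.
  - exact: measurable_funTS.
  - by move=> x _; rewrite lee_fin.
  - move=> x; rewrite /cell/= !in_itv/= intrD.
    have := idx_itv T0 k a t; rewrite -/i => /andP[h1 h2] /andP[h3 h4].
    by case: (ltP x (t + len k * i%:~R + len k)) => h5; [left|right];
      apply/andP; split; lra.
have dis : [disjoint cell k i t & cell k (i + 1) t].
  apply/disj_setPS => x [/cell_idx h1 /cell_idx h2]; exfalso.
  by move: h2; rewrite h1; lia.
rewrite ge0_integral_setU//; try exact: measurable_itv; try exact: measurable_funTS;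
  last by move=> x _; rewrite lee_fin.
rewrite (_ : 36 * eps k * len k = 18 * eps k * len k + 18 * eps k * len k); last by ring.
by rewrite EFinD; apply: leeD; exact: packing_cell.
Qed.

End packing.

(** * Average over the shifts *)

Section averaging.
Context {R : realType}.
Local Notation mu := (@lebesgue_measure R).
Local Notation TR := (measurableTypeR R).
Variables (T : R) (g : R -> R) (eps : nat -> R).
Hypothesis T0 : 0 < T.
Hypothesis gint : forall a b, mu.-integrable `[a, b] (EFin \o g).
Hypothesis eps_gt0 : forall j, 0 < eps j.
Hypothesis gosc : forall j a b, a < b -> b <= a + len T j ->
  absdev g (mean g a b) a b <= eps j * (b - a).
Local Notation len := (len T).
Local Notation idx := (idx T).
Local Notation jump := (jump T g eps).
Local Notation approx := (approx T g eps).

(** The expected cost at [x] of level [j] for a shift uniform on [[0, T]]. *)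
Definition alpha j x : \bar R :=
  (\int[mu]_(t in `[0%R, T]) (T^-1 * jump j x t)%:E)%E.

Lemma avg_jump_ge0 j x t : 0 <= T^-1 * jump j x t.
Proof. by rewrite mulr_ge0 ?invr_ge0 ?(ltW T0)//; exact: jump_ge0. Qed.

Lemma measurable_jumpt j x :
  measurable_fun setT (fun t : TR => T^-1 * jump j x t : TR).
Proof.
apply: measurable_funM => //.
exact (measurable_fun_pair2 x (measurable_jump eps T0 gint j)).
Qed.

Lemma measurable_avg_jump j :
  measurable_fun setT (fun z : TR * TR => (T^-1 * jump j z.1 z.2)%:E).
Proof.
by apply/measurable_EFinP/measurable_funM => //; exact: measurable_jump.
Qed.

Lemma alpha_ge0 j x : (0 <= alpha j x)%E.
Proof. by apply: integral_ge0 => t _; rewrite lee_fin avg_jump_ge0. Qed.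

Lemma alpha_le j x : (alpha j x <= (6 * eps j)%:E)%E.
Proof.
have w0 : 0 <= 6 * eps j by rewrite mulr_ge0// ltW.
apply: (@le_trans _ _ (\int[mu]_(t in `[0%R, T]) (T^-1 * (6 * eps j))%:E)%E).
  apply: ge0_le_integral => //.
  - by move=> t _; rewrite lee_fin avg_jump_ge0.
  - by apply/measurable_EFinP/measurable_funTS; exact: measurable_jumpt.
  - move=> t _; rewrite lee_fin ler_pM2l ?invr_gt0// /jump.
    by case: (stop _ _ _ _ _ _); rewrite ?mulr1 ?mulr0.
rewrite integral_cst//= lebesgue_measure_itv/= lte_fin T0 sube0 -EFinM lee_fin.
by rewrite mulrAC mulVf ?mul1r// gt_eqF.
Qed.

Lemma alpha_fin_num j x : alpha j x \is a fin_num.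
Proof.
by rewrite ge0_fin_numE ?alpha_ge0// (le_lt_trans (alpha_le _ _))// ltry.
Qed.

Lemma measurable_alpha j : measurable_fun setT (fun x : TR => alpha j x).
Proof.
(* Cut off outside [[0, T]], to apply Tonelli measurability for integrals over the whole line. *)
pose phi (z : TR * TR) : \bar R :=
  if (z.2 : R) \in `[0, T] then (T^-1 * jump j z.1 z.2)%:E else 0%E.
have mphi : measurable_fun setT phi.
  apply: measurable_fun_ifT => //; last exact: measurable_avg_jump.
  apply: (@measurableT_comp _ _ _ _ _ _ (fun t : TR => (t : R) \in `[0, T])) => //.
  apply: (measurable_fun_bool true); rewrite setTI.
  by rewrite (_ : _ @^-1` _ = `[0, T]%classic).
have phi0 z : (0 <= phi z)%E.
  by rewrite /phi; case: ifP => // _; rewrite lee_fin avg_jump_ge0.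
have := @measurable_fun_fubini_tonelli_F _ _ _ _ _ mu _ mphi phi0.
congr (measurable_fun _ _); apply/funext => x.
rewrite /fubini_F /alpha [RHS]integral_mkcond; apply: eq_integral => t _.
by rewrite patchE /phi/= mem_setE.
Qed.

Lemma alpha_addT (gT : forall x, g (x + T) = g x) j x : alpha j (x + T) = alpha j x.
Proof. by apply: eq_integral => t _; rewrite jump_addT. Qed.

Lemma sum_alpha (s : seq nat) x :
  (\sum_(j <- s) alpha j.+1 x =
   \int[mu]_(t in `[0%R, T]) (T^-1 * \sum_(j <- s) jump j.+1 x t)%:E)%E.
Proof.
rewrite /alpha -ge0_integral_sum//; last 2 first.
  by move=> j; apply/measurable_EFinP/measurable_funTS; exact: measurable_jumpt.
  by move=> j t _; rewrite lee_fin avg_jump_ge0.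
by apply: eq_integral => t _; rewrite sumEFin mulr_sumr.
Qed.

(** By Tonelli the integral is an average over [t] of the integrals in [packing_itv], whose bound is
    uniform in [t]. *)
Lemma integral_sum_alpha k n a b : b <= a + len k ->
  (\int[mu]_(x in `[a, b]) \sum_(k <= j < k + n) alpha j.+1 x <=
    (36 * eps k * len k)%:E)%E.
Proof.
move=> ab.
have sum0 x t : 0 <= \sum_(k <= j < k + n) jump j.+1 x t.
  by rewrite sumr_ge0// => j _; exact: jump_ge0.
have iT0 : 0 <= T^-1 by rewrite invr_ge0 ltW.
have msum : measurable_fun setT
    (fun z : TR * TR => (\sum_(k <= j < k + n) jump j.+1 z.1 z.2)%:E).
  by apply/measurable_EFinP; apply: measurable_sum => j; exact: measurable_jump.
under eq_integral => x _.
  rewrite (_ : \sum_(k <= j < k + n) alpha j.+1 x = \int[mu]_(t in `[0%R, T])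
     ((T^-1)%:E * (\sum_(k <= j < k + n) jump j.+1 x t)%:E))%E; last first.
    by rewrite sum_alpha.
  over.
rewrite (@ge0_tonelli_itv _ `[a, b]%classic `[0%R, T]%classic
  (fun z => ((T^-1)%:E * (\sum_(k <= j < k + n) jump j.+1 z.1 z.2)%:E)%E))//; last 2 first.
  by apply: emeasurable_funM.
  by move=> z; rewrite mule_ge0// lee_fin.
apply: (@le_trans _ _ (\int[mu]_(t in `[0%R, T]) (T^-1 * (36 * eps k * len k))%:E)%E).
  apply: ge0_le_integral => //=.
  - move=> t _; apply: integral_ge0 => x _; by rewrite mule_ge0// lee_fin.
  - pose phi (z : TR * TR) : \bar R := if (z.1 : R) \in `[a, b] then
        ((T^-1)%:E * (\sum_(k <= j < k + n) jump j.+1 z.1 z.2)%:E)%E else 0%E.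
    have mphi : measurable_fun setT phi.
      apply: measurable_fun_ifT => //; last exact: emeasurable_funM.
      apply: (@measurableT_comp _ _ _ _ _ _ (fun t : TR => (t : R) \in `[a, b])) => //.
      apply: (measurable_fun_bool true); rewrite setTI.
      by rewrite (_ : _ @^-1` _ = `[a, b]%classic).
    have phi0 z : (0 <= phi z)%E.
      by rewrite /phi; case: ifP => // _; rewrite mule_ge0// lee_fin.
    have := @measurable_fun_fubini_tonelli_G _ _ _ _ _ mu _ mphi phi0.
    move=> /(@measurable_funTS _ _ _ _ `[0%R, T]%classic).
    congr (measurable_fun _ _); apply/funext => t.
    rewrite /fubini_G [RHS]integral_mkcond; apply: eq_integral => x _.
    by rewrite patchE /phi/= mem_setE.
  - move=> t _; rewrite ge0_integralZl//.
    + by rewrite EFinM lee_pmul2l ?lte_fin ?invr_gt0//; exact: packing_itv.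
    + by apply: measurable_funTS; apply/measurable_EFinP; exact: measurable_sum_jump.
    + by move=> x _; rewrite lee_fin.
rewrite integral_cst//= lebesgue_measure_itv/= lte_fin T0 sube0 -EFinM lee_fin.
by rewrite mulrAC mulVf ?mul1r// gt_eqF.
Qed.

End averaging.

(** * Variation of the averaged cost within an interval *)

Section lipschitz.
Context {R : realType}.
Local Notation mu := (@lebesgue_measure R).
Local Notation TR := (measurableTypeR R).
Variables (T : R) (g : R -> R) (eps : nat -> R).
Hypothesis T0 : 0 < T.
Hypothesis gint : forall a b, mu.-integrable `[a, b] (EFin \o g).
Hypothesis eps_gt0 : forall j, 0 < eps j.
Local Notation len := (len T).
Local Notation idx := (idx T).
Local Notation jump := (jump T g eps).
Local Notation approx := (approx T g eps).
Local Notation alpha := (alpha T g eps).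

(** No smaller index is relevant: if [t <= T] and [t + len j * i] lies in [[a, b]], then [i] is at
    least [(a - T) / len j]. *)
Let grid_start j a : int := Num.floor ((a - T) / len j).

(* The translates [t] in [0, T] for which [a, b] contains a point of the grid
   [t + len j * Z] lie in the union of these intervals. *)
Let straddle j a b m : set R :=
  `[a - len j * (grid_start j a + m%:Z)%:~R, b - len j * (grid_start j a + m%:Z)%:~R]%classic.

(** The left end of the cell of [y] separates the two points, hence lies in [[a, b]]. The shifts
    range over [2 ^ j] cell lengths; [b - a <= len j] and the rounding in [grid_start] allow one
    more index each. *)
Lemma idx_straddle j a b x y t : b <= a + len j -> 0 <= t <= T ->
  a <= x <= b -> a <= y <= b -> idx j x t < idx j y t ->
  exists2 m, (m < 2 ^ j + 2)%N & straddle j a b m t.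
Proof.
move=> ab t01 xab yab; set i := idx j y t => xi.
have l0 := len_gt0 T0 j.
have xi1 : (idx j x t + 1 <= i)%R by lia.
have xi2 : (idx j x t)%:~R + 1 <= i%:~R :> R by rewrite -(intrD _ _ 1) ler_int.
have /andP[h1 h2] := idx_itv T0 j x t.
have /andP[h3 h4] := idx_itv T0 j y t.
have /andP[f1 f2] := floor_itv ((a - T) / len j).
move: f1 f2; rewrite -/(grid_start j a) ler_pdivlMr// ltr_pdivrMr//.
rewrite -/i in h3 h4; rewrite intrD => f1 f2.
have ax : len j * (idx j x t)%:~R + len j <= len j * i%:~R.
  by rewrite -[X in _ + X]mulr1 -mulrDr ler_pM2l.
have s0 : (grid_start j a)%:~R < i%:~R + 1 :> R.
  rewrite -(ltr_pM2l l0); lra.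
have s1 : (0 <= i - grid_start j a)%R.
  have : grid_start j a < i + 1 by rewrite -(ltr_int R) intrD.
  by rewrite ltzD1 subr_ge0.
exists `|(i - grid_start j a)%R|%N.
  rewrite -ltz_nat gez0_abs// -(ltr_int R) intrB PoszD intrD (_ : 2%:Z%:~R = 2 :> R)//.
  have -> : (2 ^ j)%:Z%:~R = T / len j :> R.
    by rewrite -pmulrn natrX /len invf_div mulrCA divff ?mulr1// gt_eqF.
  rewrite -(ltr_pM2l l0) mulrBr [ltRHS]mulrDr.
  by rewrite mulrCA divff ?gt_eqF// mulr1; lra.
rewrite /straddle/= in_itv/= gez0_abs// subrKC.
by apply/andP; split; lra.
Qed.

(** The costs differ only if the grid separates [x] and [y], and then the sum of indicators is at
    least 1. *)
Lemma jump_straddle j a b x y t : b <= a + len j -> 0 <= t <= T ->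
  a <= x <= b -> a <= y <= b ->
  jump j y t <= jump j x t + 6 * eps j * \sum_(m < 2 ^ j + 2) \1_(straddle j a b m) t.
Proof.
move=> ab t01 xab yab.
have w0 : 0 <= 6 * eps j by rewrite mulr_ge0// ltW.
have s0 : 0 <= \sum_(m < 2 ^ j + 2) \1_(straddle j a b m) t :> R by rewrite sumr_ge0.
have [xy|xy] := eqVneq (idx j x t) (idx j y t).
  by rewrite (jump_idx _ _ T0 xy) lerDl mulr_ge0.
have [m mj tm] : exists2 m, (m < 2 ^ j + 2)%N & straddle j a b m t.
  by case: (ltgtP (idx j x t) (idx j y t)) xy => // xy _;
    [exact: (idx_straddle ab t01 xab yab)|exact: (idx_straddle ab t01 yab xab)].
have s1 : 1 <= \sum_(m < 2 ^ j + 2) \1_(straddle j a b m) t :> R.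
  rewrite (bigD1 (Ordinal mj))//= indicE mem_set// lerDl sumr_ge0//.
have : 6 * eps j * 1 <= 6 * eps j * \sum_(m < 2 ^ j + 2) \1_(straddle j a b m) t.
  by rewrite ler_wpM2l.
rewrite mulr1; have : jump j y t <= 6 * eps j.
  by rewrite /jump; case: (stop _ _ _ _ _ _); rewrite ?mulr1 ?mulr0.
by have := jump_ge0 T g eps_gt0 j x t; lra.
Qed.

(** A random grid of mesh [len j] cuts [[a, b]] with probability at most [3 * (b - a) / len j]:
    there are [2 ^ j + 2], at most [3 * 2 ^ j], bad sets of measure at most [b - a]. Each cut costs
    at most [6 * eps j]. *)
Lemma alpha_lipschitz j a b x y : a <= b -> b <= a + len j ->
  a <= x <= b -> a <= y <= b ->
  (alpha j y <= alpha j x + (18 * eps j * (b - a) / len j)%:E)%E.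
Proof.
move=> ab0 ab xab yab; have l0 := len_gt0 T0 j.
have w0 : 0 <= 6 * eps j by rewrite mulr_ge0// ltW.
have iT0 : 0 <= T^-1 by rewrite invr_ge0 ltW.
have iTw : 0 <= T^-1 * (6 * eps j) by rewrite mulr_ge0.
have mind m : measurable_fun setT (fun t : TR => (\1_(straddle j a b m) t : R)%:E).
  by apply/measurable_EFinP; apply: measurable_indic; exact: measurable_itv.
have msum : measurable_fun setT
    (fun t : TR => \sum_(m < 2 ^ j + 2) (\1_(straddle j a b m) t : R)%:E).
  by apply: emeasurable_sum.
have sum0 (t : R) : (0 <= \sum_(m < 2 ^ j + 2) (\1_(straddle j a b m) t : R)%:E)%E.
  by apply: sume_ge0 => m _; rewrite lee_fin.
have mj z : measurable_fun `[0, T] (fun t : TR => (T^-1 * jump j z t)%:E).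
  by apply/measurable_EFinP/measurable_funTS; exact: measurable_jumpt.
apply: (@le_trans _ _ (\int[mu]_(t in `[0%R, T]) ((T^-1 * jump j x t)%:E +
   (T^-1 * (6 * eps j))%:E * \sum_(m < 2 ^ j + 2) (\1_(straddle j a b m) t : R)%:E))%E).
  apply: ge0_le_integral => //.
  - by move=> t _; rewrite lee_fin avg_jump_ge0.
  - exact: mj.
  - apply: emeasurable_funD; first exact: mj.
    by apply: emeasurable_funM => //; exact: measurable_funTS.
  - move=> t; rewrite /= in_itv/= => t01.
    rewrite sumEFin -EFinM -EFinD lee_fin -mulrA -mulrDr ler_wpM2l//.
    exact: jump_straddle.
rewrite ge0_integralD//; last 4 first.
- by move=> t _; rewrite lee_fin avg_jump_ge0.
- exact: mj.
- by move=> t _; rewrite mule_ge0// lee_fin.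
- by apply: emeasurable_funM => //; exact: measurable_funTS.
apply: leeD2l.
rewrite ge0_integralZl//; last exact: measurable_funTS.
apply: (@le_trans _ _ ((T^-1 * (6 * eps j))%:E * (\sum_(m < 2 ^ j + 2) (b - a)%:E))%E).
  rewrite lee_pmul2l ?lte_fin ?mulr_gt0 ?invr_gt0//.
  rewrite ge0_integral_sum//; last first.
    by move=> m; exact: measurable_funTS.
  apply: lee_sum => m _; rewrite integral_indic//; last exact: measurable_itv.
  apply: (@le_trans _ _ (mu (straddle j a b m))).
    apply: le_measure; rewrite ?inE; [apply: measurableI| |exact: subIsetl];
      exact: measurable_itv.
  rewrite /straddle lebesgue_measure_itv/= lte_fin ltrD2r.
  by case: ifPn => _; rewrite lee_fin ?subr_ge0//; lra.
rewrite sumEFin -EFinM lee_fin sumr_const card_ord -[(b - a) *+ _]mulr_natl natrD natrX.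
rewrite /len invf_div.
have p2 : 1 <= 2 ^+ j :> R by rewrite exprn_ege1// ler1n.
have e0 := eps_gt0 j.
rewrite [leRHS](_ : _ = T^-1 * (6 * eps j) * ((3 * 2 ^+ j) * (b - a))); last by ring.
rewrite ler_wpM2l// ler_wpM2r ?subr_ge0//; lra.
Qed.

End lipschitz.

(** * The total cost and its means *)

Section majorant.
Context {R : realType}.
Local Notation mu := (@lebesgue_measure R).
Local Notation TR := (measurableTypeR R).
Variables (T : R) (g : R -> R) (eps : nat -> R).
Hypothesis T0 : 0 < T.
Hypothesis gint : forall a b, mu.-integrable `[a, b] (EFin \o g).
Hypothesis eps_gt0 : forall j, 0 < eps j.
Hypothesis epsS : forall j, eps j <= 3 / 2 * eps j.+1.
Hypothesis gosc : forall j a b, a < b -> b <= a + len T j ->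
  absdev g (mean g a b) a b <= eps j * (b - a).
Local Notation len := (len T).
Local Notation idx := (idx T).
Local Notation jump := (jump T g eps).
Local Notation approx := (approx T g eps).
Local Notation alpha := (alpha T g eps).
Local Notation avg := (avg T g).

(* The index is shifted because no stop occurs at level 0. *)
Definition tail k x : \bar R := (\sum_(k <= j <oo) alpha j.+1 x)%E.

Lemma tail0E k x : tail 0 x = ((\sum_(0 <= j < k) alpha j.+1 x)%R + tail k x)%E.
Proof.
by rewrite /tail (@nneseries_split _ _ 0 k)// => j _; exact: alpha_ge0.
Qed.

Lemma tail_ge0 k x : (0 <= tail k x)%E.
Proof. by apply: nneseries_ge0 => j _ _; exact: alpha_ge0. Qed.

Lemma measurable_tail0 : measurable_fun setT (fun x : TR => tail 0 x).
Proof.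
apply: ge0_emeasurable_sum => j *; first exact: alpha_ge0.
exact: measurable_alpha.
Qed.

(** Going one level coarser halves the length ratio and multiplies [eps] by at most 3/2; the
    geometric series of ratio 3/4 has sum 4. *)
Lemma sum_eps_len k :
  \sum_(0 <= j < k) eps j.+1 * (len k / len j.+1) <= 4 * eps k.
Proof.
elim: k => [|k IH]; first by rewrite big_geq// mulr_ge0// ltW.
rewrite big_nat_recr//= divff ?gt_eqF ?len_gt0// mulr1.
have -> : \sum_(0 <= i < k) eps i.+1 * (len k.+1 / len i.+1) =
    2^-1 * \sum_(0 <= i < k) eps i.+1 * (len k / len i.+1).
  rewrite mulr_sumr; apply: eq_bigr => i _; rewrite (lenS T k); field.
  by rewrite gt_eqF// len_gt0.
have := epsS k; lra.
Qed.

Lemma len_le i j : (i <= j)%N -> len j <= len i.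
Proof.
move=> /subnK <-; elim: (j - i)%N => [//|n IH]; apply: le_trans IH.
by rewrite addSn (lenS T (n + i)); have := len_gt0 T0 (n + i).+1; lra.
Qed.

(** Monotone convergence; the partial sums have at least [k] terms so that they can be split at
    level [k]. *)
Lemma integral_tail0_le k a b (B : \bar R) :
  (forall n, (\int[mu]_(x in `[a, b]) (\sum_(0 <= j < k + n) alpha j.+1 x)%R <= B)%E) ->
  (\int[mu]_(x in `[a, b]) tail 0 x <= B)%E.
Proof.
move=> h; rewrite /tail integral_nneseries//; last 2 first.
  by move=> j; apply: measurable_funTS; exact: measurable_alpha.
  by move=> j x _; exact: alpha_ge0.
have i0 j : (0 <= \int[mu]_(x in `[a, b]) alpha j.+1 x)%E.
  by apply: integral_ge0 => x _; exact: alpha_ge0.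
apply: lime_le; first by apply: is_cvg_nneseries => j _ _.
apply: nearW => n; apply: le_trans (h n).
rewrite ge0_integral_sum//; last 2 first.
  by move=> j; apply: measurable_funTS; exact: measurable_alpha.
  by move=> j x _; exact: alpha_ge0.
rewrite [leRHS](@big_cat_nat _ _ _ n)//= ?leq_addl//.
by rewrite leeDl// sume_ge0.
Qed.

Lemma integral_tail0_fin a b : b <= a + T ->
  (\int[mu]_(x in `[a, b]) tail 0 x <= (36 * eps 0 * T)%:E)%E.
Proof.
move=> ab; apply: (@integral_tail0_le 0) => n.
by have := @integral_sum_alpha _ T g eps T0 gint eps_gt0 gosc 0 n a b;
  rewrite len0; apply.
Qed.

(** Coarse levels vary on [[a, b]] by at most [18 * 4 * eps k], by [alpha_lipschitz] and
    [sum_eps_len]. Fine levels have integral at most [36 * eps k * len k], and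
    [len k <= 2 * (b - a)]. Each part gives 72. *)
Lemma integral_tail0 k a b x : a < b -> len k.+1 <= b - a -> b - a <= len k ->
  a <= x <= b ->
  (\int[mu]_(y in `[a, b]) tail 0 y <=
    (b - a)%:E * ((\sum_(0 <= j < k) alpha j.+1 x)%R + (144 * eps k)%:E))%E.
Proof.
move=> ab kab abk xab; have l0 := len_gt0 T0 k.
apply: (@integral_tail0_le k) => n.
under eq_integral do rewrite (@big_cat_nat _ _ _ k)//= ?leq_addr//.
have msum s : measurable_fun `[a, b] (fun y : TR => (\sum_(j <- s) alpha j.+1 y)%E).
  by apply: emeasurable_sum => j; apply: measurable_funTS; exact: measurable_alpha.
have sum0 s y : (0 <= \sum_(j <- s) alpha j.+1 y)%E.
  by apply: sume_ge0 => j _; exact: alpha_ge0.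
rewrite ge0_integralD//; try exact: msum.
have -> : ((b - a)%:E * ((\sum_(0 <= j < k) alpha j.+1 x)%R + (144 * eps k)%:E) =
  (b - a)%:E * ((\sum_(0 <= j < k) alpha j.+1 x)%R + (72 * eps k)%:E) +
  (b - a)%:E * (72 * eps k)%:E)%E.
  rewrite -[RHS]ge0_muleDr; last 2 first.
  - by rewrite adde_ge0// lee_fin mulr_ge0// ltW.
  - by rewrite lee_fin mulr_ge0// ltW.
  by rewrite -addeA -EFinD; congr (_ * (_ + _%:E))%E; ring.
apply: leeD; last first.
  apply: le_trans (integral_sum_alpha T0 gint eps_gt0 gosc _ _) _; first lra.
  rewrite -EFinM lee_fin.
  have : eps k * len k <= eps k * (2 * (b - a)).
    by rewrite ler_wpM2l ?(ltW (eps_gt0 _))// lenS; lra.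
  lra.
apply: (@le_trans _ _ (\int[mu]_(y in `[a, b])
    ((\sum_(0 <= j < k) alpha j.+1 x)%R + (72 * eps k)%:E))%E).
  apply: ge0_le_integral => //=; first exact: msum.
  move=> y; rewrite in_itv/= => yab.
  apply: (@le_trans _ _ (\sum_(0 <= j < k)
      (alpha j.+1 x + (18 * eps j.+1 * (b - a) / len j.+1)%:E))%E).
    rewrite !big_nat; apply: lee_sum => j jk.
    apply: (@alpha_lipschitz _ _ _ _ T0 gint eps_gt0 j.+1 a b) => //; first exact: ltW.
    have : len k <= len j.+1 by apply: len_le.
    lra.
  rewrite big_split/= leeD2l// sumEFin lee_fin.
  apply: (@le_trans _ _ (\sum_(0 <= j < k) 18 * (eps j.+1 * (len k / len j.+1)))).
    apply: ler_sum => j _.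
    have : (b - a) / len j.+1 <= len k / len j.+1.
      by rewrite ler_wpM2r// invr_ge0 ltW// len_gt0.
    move=> /(ler_wpM2l (ltW (eps_gt0 j.+1))); lra.
  by rewrite -mulr_sumr; have := sum_eps_len k; lra.
have fs : (\sum_(0 <= j < k) alpha j.+1 x)%R \is a fin_num.
  by apply/sum_fin_numP => j _ _; exact: alpha_fin_num.
rewrite -(fineK fs) -EFinD integral_cst//= lebesgue_measure_itv/= lte_fin ab.
by rewrite -EFinB muleC.
Qed.

End majorant.

(** * Lebesgue points and the decrease of the function below its mean *)

Section lebesgue_points.
Context {R : realType}.
Local Notation mu := (@lebesgue_measure R).
Local Notation TR := (measurableTypeR R).
Variables (T : R) (g : R -> R) (eps : nat -> R).
Hypothesis T0 : 0 < T.
Hypothesis gint : forall a b, mu.-integrable `[a, b] (EFin \o g).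
Hypothesis eps_gt0 : forall j, 0 < eps j.
Hypothesis epsS : forall j, eps j <= 3 / 2 * eps j.+1.
Hypothesis gosc : forall j a b, a < b -> b <= a + len T j ->
  absdev g (mean g a b) a b <= eps j * (b - a).
Local Notation len := (len T).
Local Notation idx := (idx T).
Local Notation jump := (jump T g eps).
Local Notation approx := (approx T g eps).
Local Notation alpha := (alpha T g eps).
Local Notation avg := (avg T g).
Local Notation tail := (tail T g eps).
Hypothesis eps_cvg0 : eps @ \oo --> (0 : R).

Lemma locally_integrableT : locally_integrable setT g.
Proof.
split; [exact: measurable_locally_integrable|exact: openT|move=> K _ cK].
have [M [Mreal MK]] := compact_bounded cK.
have KM : K `<=` `[- (`|M| + 1), `|M| + 1].
  move=> x Kx; rewrite /= in_itv/= -ler_norml.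
  by apply: (MK (`|M| + 1)) => //; rewrite (le_lt_trans (ler_norm M))// ltrDl.
have /integrableP[mg] := gint (- (`|M| + 1)) (`|M| + 1).
apply: le_lt_trans; apply: ge0_subset_integral => //.
  exact: compact_measurable.
by apply/measurable_EFinP; apply: measurableT_comp => //; exact/measurable_EFinP.
Qed.

Lemma len_cvg0 : len j @[j --> \oo] --> (0 : R).
Proof.
rewrite -(mulr0 T); apply: cvgMr.
have -> : (fun j : nat => (2 ^+ j)^-1 : R) = (fun j => 2^-1 ^+ j).
  by apply/funext => j; rewrite exprVn.
by apply: cvg_expr; rewrite ger0_norm ?invr_ge0// invf_lt1// ltr1n.
Qed.

(** The cells shrink nicely to [x] without being centred there, which is enough for Lebesgue
    differentiation. *)
Lemma cvg_avg t x : lebesgue_pt g x -> avg j x t @[j --> \oo] --> g x.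
Proof.
move=> gx.
pose E (x : R) (j : nat) : set R :=
  `[t + len j * (idx j x t)%:~R, t + len j * (idx j x t)%:~R + len j]%classic.
have muE y j : mu (E y j) = (len j)%:E.
  rewrite /E lebesgue_measure_itv/= lte_fin ltrDl len_gt0// -EFinB.
  by rewrite [_ + len j]addrC addrK.
have hE y : nicely_shrinking y (E y).
  split; first by move=> n; exact: measurable_itv.
  have l2 j : 0 < 2 * len j by rewrite mulr_gt0// len_gt0.
  (* The ball of radius [2 * len j] contains the cell and has four times its measure. *)
  exists (4, fun j => PosNum (l2 j)); split => //=.
  - by rewrite -(mulr0 2); apply: cvgMr; exact: len_cvg0.
  - move=> j z; rewrite /E /= in_itv/= ball_itv/= in_itv/=.
    have := idx_itv T0 j y t; have := len_gt0 T0 j.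
    by move=> h1 /andP[h2 h3] /andP[h4 h5]; apply/andP; split; lra.
  - move=> j; rewrite lebesgue_measure_ball ?(ltW (l2 j))// muE -EFinM lee_fin -mulr_natl; lra.
have := nice_lebesgue_differentiation hE locally_integrableT gx.
move=> /fine_cvgP[_] /=; apply: cvg_trans; apply: near_eq_cvg; near=> j.
have dE c : c + len j - c = len j by ring.
rewrite /= muE /avg /mean dE.
rewrite -/(E x j) inver gt_eqF ?len_gt0// fineM//.
by apply: integrable_fin_num; [exact: measurable_itv|exact: gint].
Unshelve. all: by end_near. Qed.

(** Both [[a, b]] and the cell contain [x] and have length at most half of [len k], so one interval
    of length [len k] contains them. Comparison with its mean costs [4 * eps k] and [2 * eps k], and
    [epsS] turns 6 into 9. *)
Lemma mean_avg k a b x t : len k.+2 <= b - a -> b - a <= len k.+1 ->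
  a <= x <= b ->
  `|mean g a b - avg k.+1 x t| <= 9 * eps k.+1.
Proof.
move=> kab abk xab; have l0 := len_gt0 T0 k.+2.
have ab : a < b by rewrite -subr_gt0; apply: lt_le_trans kab.
set c := t + len k.+1 * (idx k.+1 x t)%:~R.
have /andP[h1 h2] := idx_itv T0 k.+1 x t; rewrite -/c in h1 h2.
pose d := Num.min a c.
have [da dc db dcl] : [/\ d <= a, d <= c, b <= d + len k & c + len k.+1 <= d + len k].
  rewrite /d (lenS T k); case: (leP a c) => ac; split => //; lra.
have dd : d < d + len k by rewrite ltrDl len_gt0.
have := gosc dd (lexx _); rewrite [d + _ - d]addrC addKr => hJ.
have := mean_sub_mean gint da ab db.
have := @mean_sub_mean _ _ gint c (c + len k.+1) d (d + len k) dc _ dcl.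
rewrite ltrDl => /(_ (len_gt0 T0 _)).
rewrite [c + _ - c]addrC addKr -/(avg k.+1 x t) => /le_trans/(_ hJ) m1 /le_trans/(_ hJ) m2.
have e1 : `|avg k.+1 x t - mean g d (d + len k)| <= 2 * eps k.
  rewrite -(ler_pM2l (len_gt0 T0 k.+1)); apply: le_trans m1 _.
  by rewrite (lenS T k); lra.
have e2 : `|mean g a b - mean g d (d + len k)| <= 4 * eps k.
  rewrite -(@ler_pM2l _ (b - a)) ?subr_gt0//; apply: le_trans m2 _.
  rewrite (lenS T k) (lenS T k.+1).
  have : eps k * len k.+2 <= eps k * (b - a) by rewrite ler_wpM2l// ltW.
  lra.
have := ler_distD (mean g d (d + len k)) (mean g a b) (avg k.+1 x t).
rewrite (distrC (mean g d _) (avg _ _ _)); have := epsS k; lra.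
Qed.

(** The limit of [avg_sum] as the fine level tends to infinity, where the average tends to [g x] and
    the last error vanishes. *)
Lemma avg_le_jump k x t : lebesgue_pt g x ->
  ((T^-1 * (avg k x t - g x - 2 * eps k))%:E <=
   \sum_(0 <= i <oo) (T^-1 * jump (i + k).+1 x t)%:E)%E.
Proof.
move=> gx.
have iT0 : 0 <= T^-1 by rewrite invr_ge0 ltW.
have j0 i : (0 <= (T^-1 * jump (i + k).+1 x t)%:E)%E.
  by rewrite lee_fin avg_jump_ge0.
set S := (X in (_ <= X)%E).
have hS n : ((T^-1 * (avg k x t - avg (n + k) x t - 2 * eps k - 2 * eps (n + k)%N))%:E <= S)%E.
  apply: (@le_trans _ _ (\sum_(0 <= i < n) (T^-1 * jump (i + k).+1 x t)%:E)%E); last first.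
    exact: nneseries_lim_ge.
  rewrite sumEFin lee_fin -mulr_sumr ler_wpM2l//.
  have := avg_sum T0 gint eps_gt0 epsS gosc k n x t.
  have -> : \sum_(k <= j < k + n) jump j.+1 x t = \sum_(0 <= i < n) jump (i + k).+1 x t.
    by rewrite -{1}(add0n k) big_addn addKn.
  rewrite (addnC k n) distrC.
  by have := ler_norm (avg k x t - avg (n + k) x t); lra.
have S0 : (0 <= S)%E by apply: nneseries_ge0 => i _ _.
(* If the sum is infinite there is nothing to prove; otherwise [hS] passes to the limit. *)
case: (S) S0 hS => [s| |] // _; last by rewrite leey.
move=> hS; rewrite lee_fin; apply: (ler_cvg_to (f := fun n =>
  T^-1 * (avg k x t - avg (n + k) x t - 2 * eps k - 2 * eps (n + k)%N)) (g := fun=> s)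
  (a := \oo)).
- have -> : avg k x t - g x - 2 * eps k = avg k x t - g x - 2 * eps k - 2 * 0.
    by rewrite mulr0 subr0.
  apply: cvgMr; apply: cvgB.
    apply: cvgB; last exact: cvg_cst.
    apply: cvgB; first exact: cvg_cst.
    by have := cvg_avg t gx; rewrite -(cvg_shiftn k).
  by apply: cvgMr; move: eps_cvg0; rewrite -(cvg_shiftn k).
- exact: cvg_cst.
- by apply: nearW => n; have := hS n; rewrite lee_fin.
Qed.

(** [avg_le_jump] is averaged over the shifts; the constant 11 is 9 from [mean_avg] plus 2 from
    [avg_le_jump]. *)
Lemma mean_le_tail k a b x : len k.+2 <= b - a -> b - a <= len k.+1 ->
  a <= x <= b -> lebesgue_pt g x ->
  ((mean g a b - g x - 11 * eps k.+1)%:E <= tail k.+1 x)%E.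
Proof.
move=> kab abk xab gx.
set m := _ - _ - _.
have iT0 : 0 <= T^-1 by rewrite invr_ge0 ltW.
(* The comparison of integrals below is for nonnegative integrands, so a negative [m] is treated
   apart. *)
have [m0|m0] := leP m 0.
  apply: (@le_trans _ _ 0%E); first by rewrite lee_fin.
  exact: tail_ge0.
rewrite /tail -nneseries_addn; last by move=> i; exact: alpha_ge0.
rewrite -(@integral_nneseries _ _ _ mu `[0%R, T]%classic _
  (fun i t => (T^-1 * jump (i + k.+1).+1 x t)%:E))//; last 2 first.
  by move=> n; apply/measurable_EFinP/measurable_funTS; exact: measurable_jumpt.
  by move=> n t _; rewrite lee_fin avg_jump_ge0.
apply: (@le_trans _ _ (\int[mu]_(t in `[0%R, T]) (T^-1 * m)%:E)%E).
  rewrite integral_cst//= lebesgue_measure_itv/= lte_fin T0 sube0 -EFinM lee_fin.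
  by rewrite mulrAC mulVf ?mul1r// gt_eqF.
apply: ge0_le_integral => //.
- by move=> t _; rewrite lee_fin mulr_ge0// ltW.
- apply: ge0_emeasurable_sum => *; first by rewrite lee_fin avg_jump_ge0.
  by apply/measurable_EFinP/measurable_funTS; exact: measurable_jumpt.
- move=> t _; apply: le_trans (avg_le_jump k.+1 t gx).
  rewrite lee_fin ler_wpM2l// /m.
  have := mean_avg t kab abk xab; rewrite ler_norml => /andP[_ h]; lra.
Qed.

End lebesgue_points.

(** * Means and essential infima *)

Section lower_oscillation.
Context {R : realType}.
Local Notation mu := (@lebesgue_measure R).

Lemma ae_imply (P Q : set R) : P `<=` Q ->
  {ae mu, forall x, P x} -> {ae mu, forall x, Q x}.
Proof.
by move=> PQ [N [mN N0 sN]]; exists N; split => // x nQ; apply: sN => /PQ.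
Qed.

Lemma ae_conj (P Q : set R) : {ae mu, forall x, P x} -> {ae mu, forall x, Q x} ->
  {ae mu, forall x, P x /\ Q x}.
Proof.
move=> [N [mN N0 sN]] [M [mM M0 sM]]; exists (N `|` M); split.
- exact: measurableU.
- by apply: null_set_setU.
- by move=> x /= /not_andP[nP|nQ]; [left; exact: sN|right; exact: sM].
Qed.

Lemma ae_mrestr (D : set R) (mD : measurable D) (P : set R) :
  {ae mu, forall x, D x -> P x} -> {ae mrestr mu mD, forall x, P x}.
Proof.
move=> [N [mN N0 sN]]; exists (N `|` ~` D); split.
- by apply: measurableU => //; exact: measurableC.
- apply: (@subset_measure0 _ _ _ mu ((N `|` ~` D) `&` D) N) => //.
    by apply: measurableI => //; apply: measurableU => //; exact: measurableC.
  by move=> x [[]].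
- move=> x /= nP; have [Dx|nDx] := pselect (D x); last by right.
  by left; apply: sN => /= h; apply: nP; exact: h.
Qed.

Lemma mrestr_ae (D : set R) (mD : measurable D) (P : set R) :
  {ae mrestr mu mD, forall x, P x} -> {ae mu, forall x, D x -> P x}.
Proof.
move=> [N [mN N0 sN]]; exists (N `&` D); split => //; first exact: measurableI.
by move=> x /= /not_implyP[Dx nP]; split => //; exact: sN.
Qed.

Lemma ae_le_mean (h : R -> R) a b c : a < b ->
  (forall a b, mu.-integrable `[a, b] (EFin \o h)) ->
  {ae mu, forall x, `[a, b]%classic x -> c <= h x} -> c <= mean h a b.
Proof.
move=> ab hint [N [mN N0 sN]].
have : 0 <= \int[mu]_(x in `[a, b]) (h x - c).
  rewrite /Rintegral (negligible_integral mN)//; last exact: integrable_sub_cst.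
  apply: fine_ge0; apply: integral_ge0 => x [xab nN]; rewrite lee_fin subr_ge0.
  by apply: contrapT => hx; apply: nN; apply: sN => /= h1; exact: hx (h1 xab).
by rewrite Rintegral_sub_cst// pmulr_rge0 ?subr_gt0// subr_ge0.
Qed.

(** Turns an almost everywhere bound into the inequality of [VLO]; the absolute value is harmless
    because the essential infimum never exceeds the mean. *)
Lemma mean_sub_ess_inf (h : R -> R) a b C : a < b ->
  (forall a b, mu.-integrable `[a, b] (EFin \o h)) ->
  {ae mu, forall x, `[a, b]%classic x -> mean h a b <= h x + C} ->
  (`|(mean h a b)%:E - ess_inf (mrestr mu (measurable_itv `[a, b])) (fun x => (h x)%:E)|
    <= C%:E)%E.
Proof.
move=> ab hint hC; set y := ess_inf _ _.
have ymin : ((mean h a b - C)%:E <= y)%E.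
  apply/ess_infP; apply: ae_mrestr; apply: ae_imply hC => x h1 xab.
  by rewrite lee_fin lerBlDr h1.
have hy : {ae mu, forall x, `[a, b]%classic x -> (y <= (h x)%:E)%E}.
  by apply: mrestr_ae; exact: ess_inf_le.
have ymax : (y <= (mean h a b)%:E)%E.
  rewrite leNgt; apply/negP => my.
  (* A real [c] is interposed since [y] could still be [+oo]. *)
  have [c mc cy] : exists2 c, mean h a b < c & (c%:E <= y)%E.
    case: (y) my => [r| |] // h1; first by exists r.
    by exists (mean h a b + 1); rewrite ?ltrDl ?leey.
  have : c <= mean h a b.
    apply: ae_le_mean => //; apply: ae_imply hy => x h1 xab.
    by rewrite -lee_fin; apply: le_trans cy (h1 xab).
  by rewrite leNgt mc.
case: (y) ymin ymax => [r| |] //; rewrite !lee_fin => h1 h2.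
rewrite ger0_norm ?subr_ge0//; lra.
Qed.

End lower_oscillation.

(** * The two lower oscillation bounds on the line *)

Section line_decomposition.
Context {R : realType}.
Local Notation mu := (@lebesgue_measure R).
Local Notation TR := (measurableTypeR R).
Variables (T : R) (g : R -> R) (eps : nat -> R).
Hypothesis T0 : 0 < T.
Hypothesis gint : forall a b, mu.-integrable `[a, b] (EFin \o g).
Hypothesis eps_gt0 : forall j, 0 < eps j.
Hypothesis epsS : forall j, eps j <= 3 / 2 * eps j.+1.
Hypothesis gosc : forall j a b, a < b -> b <= a + len T j ->
  absdev g (mean g a b) a b <= eps j * (b - a).
Local Notation len := (len T).
Local Notation idx := (idx T).
Local Notation jump := (jump T g eps).
Local Notation approx := (approx T g eps).
Local Notation alpha := (alpha T g eps).
Local Notation tail := (tail T g eps).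
Hypothesis eps_cvg0 : eps @ \oo --> (0 : R).
Hypothesis gT : forall x, g (x + T) = g x.

(** [fine] gives 0 where the total cost is infinite; by [ae_tail0_fin] this happens almost nowhere
    on an interval of length at most [T]. *)
Definition majorant x : R := fine (tail 0 x).

Lemma majorant_addT x : majorant (x + T) = majorant x.
Proof.
by congr fine; apply: eq_eseriesr => j _; exact: alpha_addT.
Qed.

Lemma measurable_majorant : measurable_fun setT (majorant : TR -> TR).
Proof.
apply: (@measurableT_comp _ _ _ _ _ _ fine); first exact: fine_measurable.
exact: measurable_tail0.
Qed.

Lemma majorant_ge0 x : 0 <= majorant x.
Proof. by apply: fine_ge0; exact: tail_ge0. Qed.

Lemma majorant_le x : ((majorant x)%:E <= tail 0 x)%E.
Proof.
rewrite /majorant; have := tail_ge0 g T0 eps_gt0 0 x.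
by case: tail => [r| |]//= _; rewrite leey.
Qed.

Lemma integral_majorant_le a b :
  (\int[mu]_(x in `[a, b]) (majorant x)%:E <= \int[mu]_(x in `[a, b]) tail 0 x)%E.
Proof.
apply: ge0_le_integral => //.
- by move=> x _; rewrite lee_fin majorant_ge0.
- by apply: measurable_funTS; apply/measurable_EFinP; exact: measurable_majorant.
- by apply: measurable_funTS; exact: measurable_tail0.
- by move=> x _; exact: majorant_le.
Qed.

Lemma integrable_majorant a b : mu.-integrable `[a, b] (EFin \o majorant).
Proof.
apply: (integrable_periodic T0 majorant_addT); apply/integrableP; split.
  by apply: measurable_funTS; apply/measurable_EFinP; exact: measurable_majorant.
under eq_integral => x _ do rewrite /= ger0_norm ?majorant_ge0//.
apply: le_lt_trans (integral_majorant_le 0 T) _.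
apply: le_lt_trans (integral_tail0_fin T0 gint eps_gt0 gosc _) _.
  by rewrite add0r.
exact: ltry.
Qed.

Lemma ae_tail0_fin a b : b <= a + T ->
  {ae mu, forall x, `[a, b]%classic x -> tail 0 x \is a fin_num}.
Proof.
move=> ab; apply: integrable_ae => //; apply/integrableP; split.
  by apply: measurable_funTS; exact: measurable_tail0.
under eq_integral => x _ do rewrite gee0_abs ?tail_ge0//.
apply: le_lt_trans (integral_tail0_fin T0 gint eps_gt0 gosc ab) _.
exact: ltry.
Qed.

(** At [x] the total cost is a coarse part plus [tail k.+1 x]. The first bound discards the tail as
    nonnegative; the second spends it on the decrease of [g] through [mean_le_tail], whence 155 =
    144 + 11. *)
Lemma ae_mean_majorant k a b : len k.+2 <= b - a -> b - a <= len k.+1 ->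
  {ae mu, forall x, `[a, b]%classic x ->
    mean majorant a b <= majorant x + 144 * eps k.+1 /\
    mean majorant a b + mean g a b <= majorant x + g x + 155 * eps k.+1}.
Proof.
move=> kab abk.
have ab : a < b by rewrite -subr_gt0; apply: lt_le_trans kab; exact: len_gt0.
have abT : b <= a + T.
  by have := len_le T0 (leq0n k.+1); rewrite len0; lra.
have := ae_conj (ae_tail0_fin abT) (lebesgue_differentiation (locally_integrableT gint)).
apply: ae_imply => x [fin gx] xab; have {}fin := fin xab.
have xab' : a <= x <= b by move: xab; rewrite /= in_itv.
have fs : (\sum_(0 <= j < k.+1) alpha j.+1 x)%R \is a fin_num.
  by apply/sum_fin_numP => j _ _; exact: alpha_fin_num.
have := integral_tail0 T0 gint eps_gt0 epsS gosc ab kab abk xab'.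
move=> /(le_trans (integral_majorant_le a b)).
have := mean_le_tail T0 gint eps_gt0 epsS gosc eps_cvg0 kab abk xab' gx.
have t0 := tail_ge0 g T0 eps_gt0 k.+1 x.
have := fin; rewrite /majorant (tail0E g T0 eps_gt0 k.+1 x).
rewrite -(fineK fs); set s := fine _.
case: (tail k.+1 x) t0 => [r| |] //=; rewrite lee_fin => r0 _.
rewrite lee_fin => h1.
have -> : (\int[mu]_(x in `[a, b]) (majorant x)%:E =
   ((b - a) * mean majorant a b)%:E)%E.
  rewrite /mean mulrA divff ?gt_eqF ?subr_gt0// mul1r fineK//.
  by apply: integrable_fin_num => //; exact: integrable_majorant.
by rewrite -EFinD -EFinM lee_fin ler_pM2l ?subr_gt0// => h2; split; lra.
Qed.

End line_decomposition.

(** * Moduli of oscillation *)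

Section envelope.
Context {R : realType}.
Variable d : nat -> R.

(* A majorant of [d] which decreases by a factor 2/3 at most; any factor larger
   than 1/2, the ratio of the cell lengths, makes [sum_eps_len] work. *)
Fixpoint envelope j : R :=
  if j is j'.+1 then Num.max (d j) (2 / 3 * envelope j') else d 0 + 1.

(** The [+ 1] at level 0 secures positivity even when [d] vanishes. *)
Lemma envelope_gt0 : (forall j, 0 <= d j) -> forall j, 0 < envelope j.
Proof.
move=> d0; elim=> [|j IH] /=; first by rewrite ltr_wpDl.
by rewrite lt_max; apply/orP; right; rewrite mulr_gt0// divr_gt0.
Qed.

Lemma envelopeS j : envelope j <= 3 / 2 * envelope j.+1.
Proof.
have : 2 / 3 * envelope j <= envelope j.+1 by rewrite /= le_max lexx orbT.
lra.
Qed.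

Lemma le_envelope j : d j <= envelope j.
Proof. by case: j => [|j] /=; rewrite ?lerDl// le_max lexx. Qed.

(** Once [d] is at most [e], the envelope decays geometrically until it is at most [e], and stays
    there. *)
Lemma cvg_envelope : (forall j, 0 <= d j) ->
  (forall e, 0 < e -> exists K, forall j, (K <= j)%N -> d j <= e) ->
  envelope @ \oo --> (0 : R).
Proof.
move=> d0 dK; apply/cvgrPdist_le => e e0.
have [K hK] := dK _ e0.
have h n : envelope (K + n)%N <= Num.max e (envelope K * (2 / 3) ^+ n).
  elim: n => [|n IH]; first by rewrite addn0 expr0 mulr1 le_max lexx orbT.
  rewrite addnS /= ge_max; apply/andP; split.
    by rewrite le_max hK// leqW// leq_addr.
  apply: (@le_trans _ _ (2 / 3 * Num.max e (envelope K * (2 / 3) ^+ n))).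
    by rewrite ler_wpM2l// divr_ge0.
  rewrite maxr_pMr ?divr_ge0// ge_max !le_max; apply/andP; split; apply/orP.
    by left; lra.
  by right; rewrite exprS mulrCA.
have z1 : `|2 / 3 : R| < 1 by rewrite ger0_norm ?divr_ge0//; lra.
have /cvgrPdist_le/(_ e e0)[N _ hN] := cvg_geometric (envelope K) z1.
exists (K + N)%N => // n /= KNn.
rewrite sub0r normrN gtr0_norm ?envelope_gt0//.
have Kn : (K <= n)%N by apply: leq_trans KNn; exact: leq_addr.
rewrite -(subnKC Kn); apply: le_trans (h _) _; rewrite ge_max lexx/=.
have := hN (n - K)%N; rewrite /= leq_subRL// => /(_ KNn).
by rewrite sub0r normrN => /(le_trans (ler_norm _)).
Qed.

End envelope.

(** * From the line to the circle *)

Section circle.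
Context {R : realType}.
Local Notation mu := (@lebesgue_measure R).
Local Notation T := (2 * pi : R).

Lemma twopi_gt0 : 0 < T.
Proof. by rewrite mulr_gt0// pi_gt0. Qed.

Lemma cis_addT (x : R) : cis (x + T) = cis x.
Proof.
have E : T = pi *+ 2 :> R by rewrite mulr_natl.
by apply: val_inj; rewrite /= E cosD2pi sinD2pi.
Qed.

(** The double angle formula makes [sin (v / 2)] vanish, but it is positive for [v] strictly between
    0 and [2 * pi]. *)
Lemma cos_eq1 (v : R) : 0 <= v < T -> cos v = 1 -> v = 0.
Proof.
move=> /andP[v0 vT] cv; apply/eqP/contraT => vn0.
have vp : 0 < v by rewrite lt_neqAle eq_sym vn0.
have w0 : 0 < v / 2 < pi by apply/andP; split; lra.
have := sin_gt0_pi w0.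
have : cos v = cos (v / 2) ^+ 2 *+ 2 - 1 by rewrite -cos_mulr2n; congr cos; lra.
rewrite cv cos2sin2 => h s0.
have : 0 < sin (v / 2) ^+ 2 by rewrite exprn_gt0.
move: h; rewrite mulr2n; lra.
Qed.

Lemma periodicz (X : Type) (A : R -> X) (P : R) : (forall x, A (x + P) = A x) ->
  forall x (i : int), A (x + P * i%:~R) = A x.
Proof.
move=> AP x i.
have APn z n : A (z + P *+ n) = A z.
  by elim: n => [|n IH]; rewrite ?mulr0n ?addr0// mulrS addrCA addrC AP.
case: i => n; first by rewrite -pmulrn mulr_natr APn.
by rewrite NegzE mulrNz mulrN -pmulrn mulr_natr -(APn (x - _) n.+1) subrK.
Qed.

(** If [cis x = cis y], then [x - y], reduced modulo the period, has cosine 1 and so is 0. *)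
Lemma periodic_cis (A : R -> R) : (forall x, A (x + T) = A x) ->
  forall x y, cis x = cis y -> A x = A y.
Proof.
move=> AT x y /(congr1 val) /= [hc hs].
have T0 := twopi_gt0.
pose n := Num.floor ((x - y) / T).
have /andP[] := floor_itv ((x - y) / T); rewrite -/n.
rewrite ler_pdivlMr// ltr_pdivrMr// intrD => n1 n2.
have v0 : 0 <= x - y + T * (- n)%:~R < T.
  by rewrite mulrNz; apply/andP; split; lra.
have : cos (x - y + T * (- n)%:~R) = 1.
  rewrite (@periodicz _ cos T); first by rewrite cosB hc hs -!expr2 cos2Dsin2.
  by move=> z; rewrite mulr_natl cosD2pi.
move=> /(cos_eq1 v0); rewrite mulrNz => xy.
have -> : x = y + T * n%:~R by lra.
exact: periodicz.
Qed.

End circle.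

(** * The oscillation modulus of a VMO function *)

Section vmo.
Context {R : realType}.
Local Notation mu := (@lebesgue_measure R).
Local Notation T := (2 * pi : R).
Variable f : circle R -> R.

Lemma arc_oscE a b : arc_osc a b f =
  (b - a)^-1 * absdev (f \o @cis R) (mean (f \o @cis R) a b) a b.
Proof. by []. Qed.

Lemma arc_osc_ge0 a b : is_arc a b -> 0 <= arc_osc a b f.
Proof.
move=> /andP[ab _]; rewrite arc_oscE mulr_ge0 ?absdev_ge0//.
by rewrite invr_ge0 subr_ge0 ltW.
Qed.

Definition osc_modulus j : R :=
  sup [set arc_osc ab.1 ab.2 f | ab in
    [set ab : R * R | is_arc ab.1 ab.2 /\ ab.2 <= ab.1 + len T j]].

Hypothesis hf : VMO f.

(** The arc from 0 to [len T j] is admissible, and the BMO bound is an upper bound. *)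
Lemma has_sup_osc_modulus j : has_sup [set arc_osc ab.1 ab.2 f | ab in
    [set ab : R * R | is_arc ab.1 ab.2 /\ ab.2 <= ab.1 + len T j]].
Proof.
have l0 := len_gt0 (@twopi_gt0 R) j; split.
  exists (arc_osc 0 (len T j) f), (0, len T j) => //=; split; last by rewrite add0r.
  rewrite /is_arc l0 add0r/=.
  by have := len_le (@twopi_gt0 R) (leq0n j); rewrite len0.
have [[_ hM] _] := hf.
pose S := [set (arc_osc ab.1 ab.2 f)%:E | ab in [set ab : R * R | is_arc ab.1 ab.2]].
have le_S a b : is_arc a b -> ((arc_osc a b f)%:E <= ereal_sup S)%E.
  by move=> ab; apply: ereal_sup_ubound; exists (a, b).
have S0 : (0 <= ereal_sup S)%E.
  have arcT : is_arc 0 T by rewrite /is_arc add0r lexx twopi_gt0.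
  by apply: le_trans (le_S _ _ arcT); rewrite lee_fin arc_osc_ge0.
exists (fine (ereal_sup S)) => _ [[a b] /= [ab _] <-].
by rewrite -lee_fin fineK ?ge0_fin_numE//; exact: le_S.
Qed.

Lemma arc_osc_le j a b : is_arc a b -> b <= a + len T j ->
  arc_osc a b f <= osc_modulus j.
Proof.
move=> ab abj; apply: (sup_upper_bound (has_sup_osc_modulus j)).
by exists (a, b).
Qed.

Lemma osc_modulus_ge0 j : 0 <= osc_modulus j.
Proof.
have l0 := len_gt0 (@twopi_gt0 R) j.
have arc : is_arc 0 (len T j).
  rewrite /is_arc l0 add0r/=.
  by have := len_le (@twopi_gt0 R) (leq0n j); rewrite len0.
by apply: le_trans (arc_osc_le (j := j) arc _); rewrite ?add0r// arc_osc_ge0.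
Qed.

Lemma osc_modulus_small (e : R) : 0 < e ->
  exists K, forall j, (K <= j)%N -> osc_modulus j <= e.
Proof.
move=> e0; have [_ /(_ e e0)[d d0 hd]] := hf.
have /cvgrPdist_lt/(_ d d0)[K _ hK] := len_cvg0 T.
exists K => j /hK/=; rewrite sub0r normrN gtr0_norm ?len_gt0 ?twopi_gt0// => ld.
apply: ge_sup; first by have [] := has_sup_osc_modulus j.
move=> _ [[a b] /= [ab abj] <-]; apply: ltW.
apply: le_lt_trans (ler_norm _) _; apply: hd => //.
by apply: le_lt_trans ld; rewrite lerBlDl.
Qed.

End vmo.

(** * Transfer of the line estimates to arcs *)

Section lift.
Context {R : realType}.
Local Notation mu := (@lebesgue_measure R).
Local Notation T := (2 * pi : R).

Definition circle_lift (A : R -> R) (z : circle R) : R :=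
  A (xget 0 [set x | cis x = z]).

Lemma circle_lift_cis (A : R -> R) : (forall x, A (x + T) = A x) ->
  forall x, circle_lift A (cis x) = A x.
Proof.
move=> AT x; apply: periodic_cis => //.
by apply: (@xgetPex _ 0 [set y | cis y = cis x]); exists x.
Qed.

(** Take the least [n] with [len L n <= l]; it exceeds [K.+1], so [n = k.+2]. The offset leaves room
    for the interval of length [len k] in [mean_avg]. *)
Lemma len_bracket (L : R) K l : 0 < L -> 0 < l -> l < len L K.+1 ->
  exists2 k, (K <= k)%N & len L k.+2 <= l /\ l <= len L k.+1.
Proof.
move=> L0 l0 lK.
have ex : exists n, len L n <= l.
  have /cvgrPdist_le/(_ l l0)[N _ hN] := len_cvg0 L.
  by exists N; have := hN N (leqnn N); rewrite sub0r normrN gtr0_norm ?len_gt0.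
have [n nl nmin] := ex_minnP ex.
have Kn : (K.+1 < n)%N.
  by rewrite ltnNge; apply/negP => /(len_le L0); lra.
case: n Kn nl nmin => [//|[//|k]] Kn nl nmin; exists k; first exact: Kn.
split => //; rewrite leNgt; apply/negP => /ltW/nmin.
by rewrite ltnn.
Qed.

(** A short arc has length between two consecutive [len], at a level so fine that [C * eps k.+1] is
    below [e]. *)
Lemma VLO_lift (h : circle R -> R) (eps : nat -> R) (C : R) :
  (forall a b, mu.-integrable `[a, b] (EFin \o (h \o @cis R))) ->
  0 <= C -> eps @ \oo --> (0 : R) ->
  (forall k a b, len T k.+2 <= b - a -> b - a <= len T k.+1 ->
    {ae mu, forall x, `[a, b]%classic x ->
      mean (h \o @cis R) a b <= h (cis x) + C * eps k.+1}) ->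
  VLO h.
Proof.
move=> hint C0 eps0 hmean; split; first exact: hint.
move=> e e0.
have : C * eps k @[k --> \oo] --> C * 0 by exact: cvgMr.
rewrite mulr0 => /cvgrPdist_lt/(_ e e0)[K _ hK].
exists (len T K.+1); first by rewrite len_gt0// twopi_gt0.
move=> a b /andP[ab _] abK.
have ba0 : 0 < b - a by rewrite subr_gt0.
have [k Kk [kab abk]] := len_bracket (@twopi_gt0 R) ba0 abK.
have := mean_sub_ess_inf ab hint (hmean k a b kab abk).
move=> /le_lt_trans; apply; rewrite lte_fin.
have := hK k.+1 (leqW Kk); rewrite /= sub0r normrN.
exact: le_lt_trans (ler_norm _).
Qed.

End lift.

Theorem corollary5p2 (R : realType) (f : circle R -> R) (hf : VMO f) :
  exists f1 f2 : circle R -> R,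
    [/\ VLO f1, VLO f2 & ae_eq_circle f (fun z => f1 z - f2 z)].
Proof.
pose T : R := 2 * pi; pose g := f \o @cis R.
have T0 : 0 < T := twopi_gt0.
have gT x : g (x + T) = g x by rewrite /g /= cis_addT.
have gint a b : lebesgue_measure.-integrable `[a, b] (EFin \o g).
  by have [[fint _] _] := hf; exact: (integrable_periodic T0 gT fint).
(* The envelope still dominates the oscillation and tends to 0, and also decreases slowly enough for
   [epsS]. *)
pose eps := envelope (osc_modulus f).
have eps_gt0 : forall j, 0 < eps j := envelope_gt0 (osc_modulus_ge0 hf).
have eps_cvg0 : eps @ \oo --> (0 : R).
  by apply: cvg_envelope; [exact: osc_modulus_ge0|exact: osc_modulus_small].
have gosc j a b : a < b -> b <= a + len T j ->
    absdev g (mean g a b) a b <= eps j * (b - a).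
  move=> ab abj; have arc : is_arc a b.
    rewrite /is_arc ab (le_trans abj)// lerD2l.
    by have := len_le T0 (leq0n j); rewrite len0.
  have := le_trans (arc_osc_le hf arc abj) (le_envelope _ j).
  by rewrite arc_oscE mulrC ler_pdivrMr ?subr_gt0.
pose A := majorant T g eps.
have AT : forall x, A (x + T) = A x := majorant_addT eps T0 gint gT.
have Aint : forall a b, lebesgue_measure.-integrable `[a, b] (EFin \o A).
  exact: integrable_majorant.
pose F := circle_lift A.
have FE : F \o @cis R = A by apply/funext => x; exact: circle_lift_cis.
have AgE : (fun z => F z + f z) \o @cis R = (fun x => A x + g x).
  by apply/funext => x /=; rewrite /F circle_lift_cis.
have Agint a b : lebesgue_measure.-integrable `[a, b] (EFin \o (fun x => A x + g x)).
  have := @integrableD _ _ _ lebesgue_measure `[a, b]%classic _ _ _ (Aint a b) (gint a b).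
  by apply.
have main := ae_mean_majorant T0 gint eps_gt0 (envelopeS _) gosc eps_cvg0 gT.
(* The constants 155 and 144 come from [ae_mean_majorant]; the identity holds at every point, so the
   exceptional set is empty. *)
exists (fun z => F z + f z), F; split.
- apply: (@VLO_lift _ _ eps 155 _ (ler0n R 155) eps_cvg0); first by rewrite AgE.
  move=> k a b kab abk; apply: ae_imply (main k a b kab abk) => x + xab.
  move=> /(_ xab)[_]; rewrite AgE /F circle_lift_cis//.
  by rewrite /mean RintegralD// mulrDr.
- apply: (@VLO_lift _ _ eps 144 _ (ler0n R 144) eps_cvg0); first by rewrite FE.
  move=> k a b kab abk; apply: ae_imply (main k a b kab abk) => x + xab.
  by move=> /(_ xab)[+ _]; rewrite FE /F circle_lift_cis.
- exists set0; split => // t ft; exfalso; apply: ft => _.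
  by rewrite [F _ + _]addrC addrK.
Qed.
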